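(* Let $(H,R,\alpha)$ be a quasitriangular Hom-Hopf algebra and $(B,\langle|\rangle,\beta)$ a coquasitriangular Hom-Hopf algebra. Then the category ${}^{B}_{H}\mathbb{L}$ of left-left $(H,B)$-Hom-Long dimodules is a braided monoidal category with braiding $$C_{M,N}:M\otimes N\to N\otimes M,\qquad m\otimes n\mapsto\langle m_{(-1)}|n_{(-1)}\rangle\, R^{(2)}\cdot\nu^{-2}(n_{(0)})\otimes R^{(1)}\cdot\mu^{-2}(m_{(0)}),$$ for all $m\in(M,\mu)\in{}^{B}_{H}\mathbb{L}$ and $n\in(N,\nu)\in{}^{B}_{H}\mathbb{L}$.
   Context: All vector spaces, maps and tensor products are over a fixed field $k$; Sweedler notation $\Delta(c)=c_1\otimes c_2$ is used, and $\rho(m)=m_{(-1)}\otimes m_{(0)}$ for coactions. A Hom-algebra $(A,\mu_A,1_A,\alpha)$: a linear space $A$ with a linear multiplication, $1_A\in A$ and a linear bijection $\alpha:A\to A$ with $\alpha(aa')=\alpha(a)\alpha(a')$, $\alpha(1_A)=1_A$, $\alpha(a)(a'a'')=(aa')\alpha(a'')$, $a1_A=1_Aa=\alpha(a)$. A left $(A,\alpha)$-Hom-module $(M,\cdot,\mu)$: a linear space $M$, linear $\cdot:A\otimes M\to M$, and a linear bijection $\mu:M\to M$ with $\mu(a\cdot m)=\alpha(a)\cdot\mu(m)$, $\alpha(a)\cdot(a'\cdot m)=(aa')\cdot\mu(m)$, $1_A\cdot m=\mu(m)$. Morphisms are linear maps $f$ with $f(a\cdot m)=a\cdot f(m)$ commuting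 with the structure maps. A Hom-coalgebra $(C,\Delta,\epsilon,\beta)$: linear $\Delta:C\to C\otimes C$, $\epsilon:C\to k$, and a linear bijection $\beta$ with $\Delta(\beta(c))=\beta(c_1)\otimes\beta(c_2)$, $\epsilon\circ\beta=\epsilon$, $\beta(c_1)\otimes c_{21}\otimes c_{22}=c_{11}\otimes c_{12}\otimes\beta(c_2)$, $\epsilon(c_1)c_2=c_1\epsilon(c_2)=\beta(c)$. A left $(C,\beta)$-Hom-comodule $(M,\rho,\mu)$: linear $\rho:M\to C\otimes M$ and a linear bijection $\mu$ with $\rho(\mu(m))=\beta(m_{(-1)})\otimes\mu(m_{(0)})$, $\epsilon(m_{(-1)})m_{(0)}=\mu(m)$, $\beta(m_{(-1)})\otimes m_{(0)(-1)}\otimes m_{(0)(0)}=m_{(-1)1}\otimes m_{(-1)2}\otimes\mu(m_{(0)})$. Morphisms are colinear maps commuting with the structure maps. A Hom-bialgebra $(H,\alpha)$: a Hom-algebra and Hom-coalgebra with the same structure map $\alpha$ such that $\Delta(hh')=\Delta(h)\Delta(h')$, $\Delta(1)=1\otimes1$, $\epsilon(hh')=\epsilon(h)\epsilon(h')$, $\epsilon(1)=1$. It is a Hom-Hopf algebra if there is a linear map $S:H\to H$ (antipode) with $S(h_1)h_2=h_1S(h_2)=\epsilon(h)1_H$ and $S\circ\alpha=\alpha\circ S$. A quasitriangular Hom-Hopf algebra $(H,R,\alpha)$: a Hom-Hopf algebra $(H,\alpha)$ with $R=R^{(1)}\otimes R^{(2)}\in H\otimes H$ (summation understood, $r=r^{(1)}\otimes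 r^{(2)}$ a second copy of $R$) such that $\epsilon(R^{(1)})R^{(2)}=R^{(1)}\epsilon(R^{(2)})=1_H$; $\Delta(R^{(1)})\otimes\alpha(R^{(2)})=\alpha(R^{(1)})\otimes\alpha(r^{(1)})\otimes R^{(2)}r^{(2)}$; $\alpha(R^{(1)})\otimes\Delta(R^{(2)})=R^{(1)}r^{(1)}\otimes\alpha(r^{(2)})\otimes\alpha(R^{(2)})$; $\Delta^{cop}(h)R=R\Delta(h)$ with $\Delta^{cop}(h)=h_2\otimes h_1$; $\alpha(R^{(1)})\otimes\alpha(R^{(2)})=R^{(1)}\otimes R^{(2)}$. A coquasitriangular Hom-Hopf algebra $(B,\langle|\rangle,\beta)$: a Hom-Hopf algebra $(B,\beta)$ with a bilinear form $\langle|\rangle:B\otimes B\to k$ such that for all $h,g,l\in B$: $\langle hg|\beta(l)\rangle=\langle\beta(h)|l_2\rangle\langle\beta(g)|l_1\rangle$; $\langle\beta(h)|gl\rangle=\langle h_1|\beta(g)\rangle\langle h_2|\beta(l)\rangle$; $\langle h_1|g_1\rangle g_2h_2=h_1g_1\langle h_2|g_2\rangle$; $\langle1|h\rangle=\langle h|1\rangle=\epsilon(h)$; $\langle\beta(h)|\beta(g)\rangle=\langle h|g\rangle$. A left-left $(H,B)$-Hom-Long dimodule $(M,\cdot,\rho,\mu)$: $(M,\cdot,\mu)$ is a left $(H,\alpha)$-Hom-module and $(M,\rho,\mu)$ is a left $(B,\beta)$-Hom-comodule with $\rho(h\cdot m)=\beta(m_{(-1)})\otimes\alpha(h)\cdot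 m_{(0)}$. The category ${}^{B}_{H}\mathbb{L}$ has these as objects and, as morphisms, the $H$-linear $B$-colinear maps commuting with structure maps. Monoidal structure on ${}^{B}_{H}\mathbb{L}$: for $(M,\mu),(N,\nu)$, the tensor product is $(M\otimes N,\mu\otimes\nu)$ with $h\cdot(m\otimes n)=h_1\cdot m\otimes h_2\cdot n$ and $\rho(m\otimes n)=\beta^{-2}(m_{(-1)}n_{(-1)})\otimes m_{(0)}\otimes n_{(0)}$; the unit is $I=(k,\mathrm{id})$ with $h\cdot 1=\epsilon(h)$, $\rho(1)=1_B\otimes1$; for $(U,\mu),(V,\nu),(W,\omega)$ the associator is $a_{U,V,W}((u\otimes v)\otimes w)=\mu^{-1}(u)\otimes(v\otimes\omega(w))$, and the unit constraints are $l_V(\lambda\otimes v)=\lambda\nu(v)$, $r_V(v\otimes\lambda)=\lambda\nu(v)$ for $\lambda\in k$.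
   Formalization: The unit constraints are taken as l_V(λ⊗v) = r_V(v⊗λ) = λν⁻¹(v) instead of λν(v), because with λν(v) the triangle axiom and H-linearity fail for the given associator. *)

(* Defs.v *)
From HB Require Import structures.
From mathcomp Require Import all_boot all_algebra.
From mathcomp Require Import boolp.

Set Implicit Arguments.
Unset Strict Implicit.
Unset Printing Implicit Defensive.

Import GRing.Theory.
Local Open Scope ring_scope.
Local Open Scope quotient_scope.

(** Tensor products of vector spaces:

    [U ⊗ V] is the quotient of the formal sums of pairs [(u, v)] (encoded as
    finite sequences) by the least congruence that makes concatenation
    commutative and pairing bilinear.  Opposites and scalar multiples are taken
    on the first components. *)

Section Tensor.
Variables (k : fieldType) (U V : lmodType k).

Inductive tens_eqv : seq (U * V) -> seq (U * V) -> Prop :=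
| tens_refl s : tens_eqv s s
| tens_sym s t : tens_eqv s t -> tens_eqv t s
| tens_trans s t r : tens_eqv s t -> tens_eqv t r -> tens_eqv s r
| tens_cat s s' t t' :
    tens_eqv s s' -> tens_eqv t t' -> tens_eqv (s ++ t) (s' ++ t')
| tens_comm s t : tens_eqv (s ++ t) (t ++ s)
| tens_addl u u' v : tens_eqv [:: (u + u', v)] [:: (u, v); (u', v)]
| tens_addr u v v' : tens_eqv [:: (u, v + v')] [:: (u, v); (u, v')]
| tens_scale a u v : tens_eqv [:: (a *: u, v)] [:: (u, a *: v)]
| tens_zero v : tens_eqv [:: (0, v)] [::].

Definition tens_rel (s t : seq (U * V)) : bool := `[< tens_eqv s t >].

Lemma tens_rel_refl : reflexive tens_rel.
Proof. by move=> s; apply/asboolP; exact: tens_refl. Qed.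

Lemma tens_rel_sym : symmetric tens_rel.
Proof. by move=> s t; apply/asboolP/asboolP; exact: tens_sym. Qed.

Lemma tens_rel_trans : transitive tens_rel.
Proof.
by move=> t s r /asboolP st /asboolP tr; apply/asboolP; exact: tens_trans tr.
Qed.

Canonical tens_equiv : equiv_rel (seq (U * V)) :=
  EquivRel tens_rel tens_rel_refl tens_rel_sym tens_rel_trans.

Definition tensor := {eq_quot tens_equiv}.
HB.instance Definition _ := Choice.on tensor.
HB.instance Definition _ : EqQuotient _ tens_equiv tensor := EqQuotient.on tensor.

Definition tens_cls (s : seq (U * V)) : tensor := \pi_tensor s.

Lemma tens_clsP s t : tens_eqv s t -> tens_cls s = tens_cls t.
Proof. by move=> st; apply/(@eqquotP _ _ tensor)/asboolP. Qed.

Lemma tens_repr s : tens_eqv (repr (tens_cls s)) s.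
Proof. by apply/asboolP/(@eqquotP _ _ tensor); rewrite reprK. Qed.

Definition tens_scale_seq (a : k) (s : seq (U * V)) :=
  [seq (a *: p.1, p.2) | p <- s].

Lemma tens_scale_seq_eqv a s t :
  tens_eqv s t -> tens_eqv (tens_scale_seq a s) (tens_scale_seq a t).
Proof.
elim=> {s t} [s|s t _|s t r _ st _|s s' t t' _ ss' _ tt'|s t|u u' v|u v v'
  |b u v|v].
- exact: tens_refl.
- exact: tens_sym.
- exact: tens_trans st.
- by rewrite /tens_scale_seq !map_cat; exact: tens_cat.
- by rewrite /tens_scale_seq !map_cat; exact: tens_comm.
- by rewrite /= scalerDr; exact: tens_addl.
- exact: tens_addr.
- by rewrite /= scalerA mulrC -scalerA; exact: tens_scale.
- by rewrite /= scaler0; exact: tens_zero.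
Qed.

Definition tens_add (x y : tensor) : tensor := tens_cls (repr x ++ repr y).
Definition tens_scalem (a : k) (x : tensor) : tensor :=
  tens_cls (tens_scale_seq a (repr x)).

Lemma tens_addE s t : tens_add (tens_cls s) (tens_cls t) = tens_cls (s ++ t).
Proof. by apply: tens_clsP; apply: tens_cat; exact: tens_repr. Qed.

Lemma tens_scaleE a s : tens_scalem a (tens_cls s) = tens_cls (tens_scale_seq a s).
Proof. by apply/tens_clsP/tens_scale_seq_eqv/tens_repr. Qed.

Lemma tens_clsW (P : tensor -> Prop) :
  (forall s, P (tens_cls s)) -> forall x, P x.
Proof. by move=> Ps x; rewrite -[x]reprK; exact: Ps. Qed.

Lemma tens_addA : associative tens_add.
Proof.
elim/tens_clsW=> s; elim/tens_clsW=> t; elim/tens_clsW=> r.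
by rewrite !tens_addE catA.
Qed.

Lemma tens_addC : commutative tens_add.
Proof.
elim/tens_clsW=> s; elim/tens_clsW=> t; rewrite !tens_addE.
by apply: tens_clsP; exact: tens_comm.
Qed.

Lemma tens_add0 : left_id (tens_cls [::]) tens_add.
Proof. by elim/tens_clsW=> s; rewrite tens_addE. Qed.

Lemma tens_scale_seqDl a b s :
  tens_eqv (tens_scale_seq (a + b) s) (tens_scale_seq a s ++ tens_scale_seq b s).
Proof.
elim: s => [|[u v] s IHs] /=; first exact: tens_refl.
have := tens_cat (tens_addl (a *: u) (b *: u) v) IHs.
rewrite -scalerDl /= => st; apply: tens_trans st _.
have := tens_cat (tens_refl [:: (a *: u, v)]) (tens_cat
  (tens_comm [:: (b *: u, v)] (tens_scale_seq a s))
  (tens_refl (tens_scale_seq b s))).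
by rewrite -!catA.
Qed.

Lemma tens_scale_seq0 s : tens_eqv (tens_scale_seq 0 s) [::].
Proof.
elim: s => [|[u v] s IHs] /=; first exact: tens_refl.
by rewrite scale0r; exact: tens_cat (tens_zero v) IHs.
Qed.

Lemma tens_scale_seq1 s : tens_scale_seq 1 s = s.
Proof.
by rewrite -[RHS]map_id; apply: eq_map => -[u v] /=; rewrite scale1r.
Qed.

Lemma tens_addN : left_inverse (tens_cls [::]) (tens_scalem (- 1)) tens_add.
Proof.
elim/tens_clsW=> s; rewrite tens_scaleE tens_addE; apply: tens_clsP.
rewrite -[X in _ ++ X]tens_scale_seq1.
apply: tens_trans (tens_sym (tens_scale_seqDl _ _ _)) _.
by rewrite addNr; exact: tens_scale_seq0.
Qed.

HB.instance Definition _ :=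
  GRing.isZmodule.Build tensor tens_addA tens_addC tens_add0 tens_addN.

Lemma tens_clsD s t : tens_cls (s ++ t) = tens_cls s + tens_cls t.
Proof. by rewrite -tens_addE. Qed.

Lemma tens_cls0 : tens_cls [::] = 0.
Proof. by []. Qed.

Lemma tens_scaleA a b x :
  tens_scalem a (tens_scalem b x) = tens_scalem (a * b) x.
Proof.
elim/tens_clsW: x => s; rewrite !tens_scaleE /tens_scale_seq -map_comp.
by congr tens_cls; apply: eq_map => -[u v] /=; rewrite scalerA.
Qed.

Lemma tens_scale1 : left_id 1 tens_scalem.
Proof. by elim/tens_clsW=> s; rewrite tens_scaleE tens_scale_seq1. Qed.

Lemma tens_scaleDr : right_distributive tens_scalem +%R.
Proof.
move=> a; elim/tens_clsW=> s; elim/tens_clsW=> t.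
by rewrite -tens_clsD !tens_scaleE -tens_clsD /tens_scale_seq map_cat.
Qed.

Lemma tens_scaleDl x : {morph tens_scalem^~ x : a b / a + b}.
Proof.
move=> a b /=; elim/tens_clsW: x => s; rewrite !tens_scaleE -tens_clsD.
by apply: tens_clsP; exact: tens_scale_seqDl.
Qed.

HB.instance Definition _ := GRing.Zmodule_isLmodule.Build k tensor
  tens_scaleA tens_scale1 tens_scaleDr tens_scaleDl.

Definition tens (u : U) (v : V) : tensor := tens_cls [:: (u, v)].

End Tensor.

Arguments tensor {k} (U V)%_type_scope.
Arguments tens {k U V} u v : simpl never.

Notation "U ⊗ V" := (tensor U V) (at level 40, left associativity) : type_scope.
Notation "u ⊗ v" := (tens u v) (at level 40, left associativity) : ring_scope.

(** Sweedler notation: the sum of [f u v] over the terms [u ⊗ v] of some chosen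
    decomposition of [t].  It depends on that choice unless [f] is bilinear, see
    [sweedler_tens] and [sweedler_linear]. *)
Definition sweedler (k : fieldType) (U V : lmodType k) (W : nmodType)
    (t : U ⊗ V) (f : U -> V -> W) : W :=
  \sum_(p <- repr t) f p.1 p.2.

Notation "\sw_ ( u , v <- t ) E" := (sweedler t (fun u v => E))
  (at level 41, u name, v name, E at level 41,
   format "'[' \sw_ ( u ,  v  <-  t ) '/  '  E ']'") : ring_scope.

Section TensorTheory.
Variable k : fieldType.

Definition islin (U V : lmodType k) (f : U -> V) :=
  forall a x y, f (a *: x + y) = a *: f x + f y.
Definition isbilin (U V W : lmodType k) (f : U -> V -> W) :=
  (forall v, islin (f^~ v)) /\ (forall u, islin (f u)).

Lemma islin_linear (U V : lmodType k) (f : {linear U -> V}) : islin f.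
Proof. by move=> a x y; rewrite linearP. Qed.

Lemma islin0 (U V : lmodType k) (f : U -> V) : islin f -> f 0 = 0.
Proof. by move=> lf; have := lf (-1) 0 0; rewrite scaler0 addr0 scaleN1r addNr. Qed.

Lemma islinD (U V : lmodType k) (f : U -> V) : islin f -> {morph f : x y / x + y}.
Proof. by move=> lf x y; have := lf 1 x y; rewrite !scale1r. Qed.

Lemma islinZ (U V : lmodType k) (f : U -> V) a x : islin f -> f (a *: x) = a *: f x.
Proof. by move=> lf; have := lf a x 0; rewrite (islin0 lf) !addr0. Qed.

Section UV.
Variables U V : lmodType k.

Lemma tensDl (u u' : U) (v : V) : (u + u') ⊗ v = u ⊗ v + u' ⊗ v.
Proof. by rewrite /tens -tens_clsD; apply: tens_clsP; exact: tens_addl. Qed.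

Lemma tensDr (u : U) (v v' : V) : u ⊗ (v + v') = u ⊗ v + u ⊗ v'.
Proof. by rewrite /tens -tens_clsD; apply: tens_clsP; exact: tens_addr. Qed.

Lemma tensZl a (u : U) (v : V) : (a *: u) ⊗ v = a *: (u ⊗ v).
Proof. by rewrite /tens -[RHS]/(tens_scalem _ _) tens_scaleE. Qed.

Lemma tensZr a (u : U) (v : V) : u ⊗ (a *: v) = a *: (u ⊗ v).
Proof.
by rewrite -tensZl /tens; apply: tens_clsP; apply: tens_sym; exact: tens_scale.
Qed.

Lemma tens_bilin : isbilin (@tens k U V).
Proof.
by split=> [v|u] a x y; rewrite ?tensDl ?tensZl ?tensDr ?tensZr.
Qed.

Lemma tens_cls_sum (s : seq (U * V)) : tens_cls s = \sum_(p <- s) p.1 ⊗ p.2.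
Proof.
elim: s => [|[u v] s IHs]; first by rewrite big_nil.
by rewrite big_cons -IHs /tens -tens_clsD.
Qed.

Lemma sweedlerE (t : U ⊗ V) : \sw_(u, v <- t) (u ⊗ v) = t.
Proof. by rewrite /sweedler -tens_cls_sum /tens_cls reprK. Qed.

Lemma tens_eqv_sum (W : lmodType k) (f : U -> V -> W) s t : isbilin f ->
  tens_eqv s t -> \sum_(p <- s) f p.1 p.2 = \sum_(p <- t) f p.1 p.2.
Proof.
case=> fl fr.
elim=> {s t} //.
- by move=> s t r _ -> _ ->.
- by move=> s s' t t' _ IHs _ IHt; rewrite !big_cat /= IHs IHt.
- by move=> s t; rewrite !big_cat /= addrC.
- by move=> u u' v; rewrite !big_cons !big_nil /= addr0 (islinD (fl v)) addr0.
- by move=> u v v'; rewrite !big_cons !big_nil /= addr0 (islinD (fr u)) addr0.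
- move=> a u v; rewrite !big_cons !big_nil /= !addr0.
  by rewrite (islinZ _ _ (fl v)) (islinZ _ _ (fr u)).
- by move=> v; rewrite !big_cons !big_nil /= (islin0 (fl v)) addr0.
Qed.

Lemma sweedler_cls (W : lmodType k) (f : U -> V -> W) s : isbilin f ->
  sweedler (tens_cls s) f = \sum_(p <- s) f p.1 p.2.
Proof. by move=> bf; apply: tens_eqv_sum => //; exact: tens_repr. Qed.

Lemma sweedler_tens (W : lmodType k) (f : U -> V -> W) u v : isbilin f ->
  sweedler (u ⊗ v) f = f u v.
Proof. by move=> bf; rewrite sweedler_cls // big_cons big_nil addr0. Qed.

Lemma sweedler_linear (W : lmodType k) (f : U -> V -> W) : isbilin f ->
  islin (fun t => sweedler t f).
Proof.
move=> bf a; elim/tens_clsW=> s; elim/tens_clsW=> t.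
rewrite -[a *: _]/(tens_scalem _ _) tens_scaleE -tens_clsD !sweedler_cls //.
rewrite big_cat /=; congr (_ + _); rewrite big_map scaler_sumr.
by apply: eq_bigr => -[u v] _ /=; rewrite (islinZ _ _ (bf.1 v)).
Qed.

Lemma tens_lin_eq (W : lmodType k) (f g : U ⊗ V -> W) : islin f -> islin g ->
  (forall u v, f (u ⊗ v) = g (u ⊗ v)) -> forall t, f t = g t.
Proof.
move=> lf lg fg; elim/tens_clsW=> s; rewrite tens_cls_sum.
elim: s => [|p s IHs]; first by rewrite big_nil !islin0.
by rewrite !big_cons (islinD lf) (islinD lg) fg IHs.
Qed.

Lemma sweedler_comb (W : lmodType k) (t : U ⊗ V) a (f g : U -> V -> W) :
  \sw_(u, v <- t) (a *: f u v + g u v) = a *: sweedler t f + sweedler t g.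
Proof. by rewrite /sweedler big_split /= scaler_sumr. Qed.

Lemma lin_sweedler (W W' : lmodType k) (g : W -> W') (t : U ⊗ V) f : islin g ->
  g (sweedler t f) = \sw_(u, v <- t) g (f u v).
Proof.
move=> lg; rewrite /sweedler; elim: (repr t) => [|p s IHs].
  by rewrite !big_nil islin0.
by rewrite !big_cons (islinD lg) IHs.
Qed.

Lemma eq_sweedler (W : nmodType) (t : U ⊗ V) (f g : U -> V -> W) :
  (forall u v, f u v = g u v) -> sweedler t f = sweedler t g.
Proof. by move=> fg; apply: eq_bigr => p _; exact: fg. Qed.

End UV.

Lemma exchange_sweedler (U V U' V' : lmodType k) (W : nmodType)
    (t : U ⊗ V) (t' : U' ⊗ V') (f : U -> V -> U' -> V' -> W) :
  \sw_(u, v <- t) \sw_(u', v' <- t') f u v u' v' =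
  \sw_(u', v' <- t') \sw_(u, v <- t) f u v u' v'.
Proof. exact: exchange_big. Qed.

Lemma islin_id (U : lmodType k) : islin (fun x : U => x).
Proof. by []. Qed.

Lemma islin_comp (U V W : lmodType k) (f : V -> W) (g : U -> V) :
  islin f -> islin g -> islin (fun x => f (g x)).
Proof. by move=> lf lg a x y; rewrite lg lf. Qed.

Lemma islin_tensl (U V W : lmodType k) (g : W -> U) (v : V) :
  islin g -> islin (fun x => g x ⊗ v).
Proof. by move=> lg a x y; rewrite lg tensDl tensZl. Qed.

Lemma islin_tensr (U V W : lmodType k) (g : W -> V) (u : U) :
  islin g -> islin (fun x => u ⊗ g x).
Proof. by move=> lg a x y; rewrite lg tensDr tensZr. Qed.

Lemma islin_scaler (U V : lmodType k) (g : U -> V) b :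
  islin g -> islin (fun x => b *: g x).
Proof. by move=> lg a x y; rewrite lg scalerDr !scalerA mulrC. Qed.

Lemma islin_scalel (U V : lmodType k) (g : U -> k) (v : V) :
  islin (g : U -> k^o) -> islin (fun x => g x *: v).
Proof. by move=> lg a x y; rewrite lg scalerDl scalerA. Qed.

Lemma islin_sweedler (U V W T : lmodType k) (t : T -> U ⊗ V) (f : U -> V -> W) :
  isbilin f -> islin t -> islin (fun x => sweedler (t x) f).
Proof. by move=> bf lt a x y; rewrite lt; exact: sweedler_linear. Qed.

Lemma islin_sweedlerf (U V W T : lmodType k) (t : U ⊗ V) (f : T -> U -> V -> W) :
  (forall u v, islin (fun x => f x u v)) -> islin (fun x => sweedler t (f x)).
Proof.
by move=> lf a x y; rewrite -sweedler_comb; apply: eq_sweedler => u v; exact: lf.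
Qed.

End TensorTheory.

Definition mklin (k : fieldType) (U V : lmodType k) (f : U -> V) (lf : islin f) :
    {linear U -> V} :=
  HB.pack f (GRing.isLinear.Build k U V *:%R f lf).

(** Linear bijections are given with their (unique) inverse. *)
Record lin_auto (k : fieldType) (V : lmodType k) := LinAuto {
  auto_fun :> {linear V -> V};
  auto_inv : V -> V;
  auto_funK : cancel auto_fun auto_inv;
  auto_invK : cancel auto_inv auto_fun }.

Lemma islin_inv (k : fieldType) (V : lmodType k) (f : lin_auto V) :
  islin (auto_inv f).
Proof. by move=> a x y; apply: (can_inj (auto_funK f)); rewrite linearP !auto_invK. Qed.

(** Solves linearity goals by recursion on the syntax of the function. *)
Ltac lin := intros; cbv beta; match goal with
  | |- isbilin _ => split; lin
  | |- islin (fun x => x) => exact: islin_id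
  | |- islin (fun x => sweedler ?t (@?f x)) =>
      apply: (@islin_sweedlerf _ _ _ _ _ t f); lin
  | |- islin (fun x => sweedler (@?t x) ?f) =>
      apply: (@islin_sweedler _ _ _ _ _ t f); lin
  | |- islin (fun x => ?u ⊗ (@?g x)) => apply: (@islin_tensr _ _ _ _ g u); lin
  | |- islin (fun x => (@?g x) ⊗ ?v) => apply: (@islin_tensl _ _ _ _ g v); lin
  | |- islin (fun x => ?b *: (@?g x)) => apply: (@islin_scaler _ _ _ g b); lin
  | |- islin (fun x => (@?g x) *: ?v) => apply: (@islin_scalel _ _ _ g v); lin
  | |- islin (fun x => auto_inv ?f (@?g x)) =>
      apply: (@islin_comp _ _ _ _ (auto_inv f) g); [exact: islin_inv|lin]
  | |- islin (auto_inv _) => exact: islin_inv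
  | |- islin (fun x => ?f (@?g x)) =>
      apply: (@islin_comp _ _ _ _ f g); [exact: islin_linear|lin]
  | |- islin _ => exact: islin_linear
  end.


Section HomStructures.
Variable k : fieldType.

Record is_hom_algebra (A : lmodType k) (mul : {linear (A ⊗ A)%type -> A})
    (one : A) (al : lin_auto A) : Prop := IsHomAlgebra {
  ha_mapM : forall a b, al (mul (a ⊗ b)) = mul (al a ⊗ al b);
  ha_map1 : al one = one;
  ha_assoc : forall a b c, mul (al a ⊗ mul (b ⊗ c)) = mul (mul (a ⊗ b) ⊗ al c);
  ha_mulr1 : forall a, mul (a ⊗ one) = al a;
  ha_mul1r : forall a, mul (one ⊗ a) = al a }.

Record is_hom_coalgebra (C : lmodType k) (comul : {linear C -> (C ⊗ C)%type})
    (counit : {linear C -> k^o}) (be : lin_auto C) : Prop := IsHomCoalgebra {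
  hc_map_comul : forall c,
    comul (be c) = \sw_(c1, c2 <- comul c) (be c1 ⊗ be c2);
  hc_map_counit : forall c, counit (be c) = counit c;
  hc_coassoc : forall c,
    \sw_(c1, c2 <- comul c) \sw_(c21, c22 <- comul c2) (be c1 ⊗ (c21 ⊗ c22)) =
    \sw_(c1, c2 <- comul c) \sw_(c11, c12 <- comul c1) (c11 ⊗ (c12 ⊗ be c2));
  hc_counitl : forall c, \sw_(c1, c2 <- comul c) (counit c1 *: c2) = be c;
  hc_counitr : forall c, \sw_(c1, c2 <- comul c) (counit c2 *: c1) = be c }.

Record homHopf := HomHopf {
  hh_sort :> lmodType k;
  hh_mul : {linear (hh_sort ⊗ hh_sort)%type -> hh_sort};
  hone : hh_sort;
  comul : {linear hh_sort -> (hh_sort ⊗ hh_sort)%type};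
  counit : {linear hh_sort -> k^o};
  hmap : lin_auto hh_sort;
  antipode : {linear hh_sort -> hh_sort};
  hh_algebra : is_hom_algebra hh_mul hone hmap;
  hh_coalgebra : is_hom_coalgebra comul counit hmap;
  hh_comulM : forall g h, comul (hh_mul (g ⊗ h)) =
    \sw_(g1, g2 <- comul g) \sw_(h1, h2 <- comul h)
      (hh_mul (g1 ⊗ h1) ⊗ hh_mul (g2 ⊗ h2));
  hh_comul1 : comul hone = hone ⊗ hone;
  hh_counitM : forall g h, counit (hh_mul (g ⊗ h)) = counit g * counit h;
  hh_counit1 : counit hone = 1;
  hh_antipodel : forall h,
    \sw_(h1, h2 <- comul h) hh_mul (antipode h1 ⊗ h2) = counit h *: hone;
  hh_antipoder : forall h,
    \sw_(h1, h2 <- comul h) hh_mul (h1 ⊗ antipode h2) = counit h *: hone;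
  hh_antipode_map : forall h, antipode (hmap h) = hmap (antipode h) }.

End HomStructures.

Arguments hone {k} _.
Arguments comul {k _}.
Arguments counit {k _}.
Arguments hmap {k _}.
Arguments antipode {k _}.
Notation "x ∗ y" := (hh_mul _ (x ⊗ y)) (at level 40, left associativity) : ring_scope.

Record quasitriangular (k : fieldType) (H : homHopf k) (R : H ⊗ H) : Prop :=
    Quasitriangular {
  qt_counitl : \sw_(R1, R2 <- R) (counit R1 *: R2) = hone H;
  qt_counitr : \sw_(R1, R2 <- R) (counit R2 *: R1) = hone H;
  qt_comull :
    \sw_(R1, R2 <- R) \sw_(R11, R12 <- comul R1) (R11 ⊗ (R12 ⊗ hmap R2)) =
    \sw_(R1, R2 <- R) \sw_(r1, r2 <- R) (hmap R1 ⊗ (hmap r1 ⊗ (R2 ∗ r2)));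
  qt_comulr :
    \sw_(R1, R2 <- R) \sw_(R21, R22 <- comul R2) (hmap R1 ⊗ (R21 ⊗ R22)) =
    \sw_(R1, R2 <- R) \sw_(r1, r2 <- R) ((R1 ∗ r1) ⊗ (hmap r2 ⊗ hmap R2));
  qt_comm : forall h : H,
    \sw_(h1, h2 <- comul h) \sw_(R1, R2 <- R) ((h2 ∗ R1) ⊗ (h1 ∗ R2)) =
    \sw_(h1, h2 <- comul h) \sw_(R1, R2 <- R) ((R1 ∗ h1) ⊗ (R2 ∗ h2));
  qt_map : \sw_(R1, R2 <- R) (hmap R1 ⊗ hmap R2) = R }.

Record coquasitriangular (k : fieldType) (B : homHopf k)
    (form : {linear (B ⊗ B)%type -> k^o}) : Prop := Coquasitriangular {
  cqt_mull : forall h g l : B, form ((h ∗ g) ⊗ hmap l) =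
    \sw_(l1, l2 <- comul l) (form (hmap h ⊗ l2) * form (hmap g ⊗ l1));
  cqt_mulr : forall h g l : B, form (hmap h ⊗ (g ∗ l)) =
    \sw_(h1, h2 <- comul h) (form (h1 ⊗ hmap g) * form (h2 ⊗ hmap l));
  cqt_comm : forall h g : B,
    \sw_(h1, h2 <- comul h) \sw_(g1, g2 <- comul g)
      (form (h1 ⊗ g1) *: (g2 ∗ h2)) =
    \sw_(h1, h2 <- comul h) \sw_(g1, g2 <- comul g)
      (form (h2 ⊗ g2) *: (h1 ∗ g1));
  cqt_1l : forall h : B, form (hone B ⊗ h) = counit h;
  cqt_1r : forall h : B, form (h ⊗ hone B) = counit h;
  cqt_map : forall h g : B, form (hmap h ⊗ hmap g) = form (h ⊗ g) }.


Section Long.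
Variables (k : fieldType) (H B : homHopf k).

Record is_hom_module (M : lmodType k) (act : {linear (H ⊗ M)%type -> M})
    (mu : lin_auto M) : Prop := IsHomModule {
  hm_map : forall h m, mu (act (h ⊗ m)) = act (hmap h ⊗ mu m);
  hm_assoc : forall h h' m,
    act (hmap h ⊗ act (h' ⊗ m)) = act ((h ∗ h') ⊗ mu m);
  hm_unit : forall m, act (hone H ⊗ m) = mu m }.

Record is_hom_comodule (M : lmodType k) (rho : {linear M -> (B ⊗ M)%type})
    (mu : lin_auto M) : Prop := IsHomComodule {
  hcm_map : forall m, rho (mu m) = \sw_(b, m0 <- rho m) (hmap b ⊗ mu m0);
  hcm_counit : forall m, \sw_(b, m0 <- rho m) (counit b *: m0) = mu m;
  hcm_coassoc : forall m,
    \sw_(b, m0 <- rho m) \sw_(b', m00 <- rho m0) (hmap b ⊗ (b' ⊗ m00)) =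
    \sw_(b, m0 <- rho m) \sw_(b1, b2 <- comul b) (b1 ⊗ (b2 ⊗ mu m0)) }.

Record longDimodule := LongDimodule {
  ld_sort :> lmodType k;
  act : {linear (H ⊗ ld_sort)%type -> ld_sort};
  coact : {linear ld_sort -> (B ⊗ ld_sort)%type};
  ld_map : lin_auto ld_sort;
  ld_module : is_hom_module act ld_map;
  ld_comodule : is_hom_comodule coact ld_map;
  ld_compat : forall h m, coact (act (h ⊗ m)) =
    \sw_(b, m0 <- coact m) (hmap b ⊗ act (hmap h ⊗ m0)) }.

Record longHom (M N : longDimodule) := LongHom {
  lh_fun :> {linear M -> N};
  lh_act : forall h m, lh_fun (act M (h ⊗ m)) = act N (h ⊗ lh_fun m);
  lh_coact : forall m,
    coact N (lh_fun m) = \sw_(b, m0 <- coact M m) (b ⊗ lh_fun m0);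
  lh_map : forall m, lh_fun (ld_map M m) = ld_map N (lh_fun m) }.

End Long.

Arguments act {k H B _}.
Arguments coact {k H B _}.
Arguments ld_map {k H B _}.
Notation "h ▹ m" := (act (h ⊗ m)) (at level 40, left associativity) : ring_scope.

Lemma linear_eq (k : fieldType) (U V : lmodType k) (f g : {linear U -> V}) :
  f =1 g -> f = g.
Proof.
case: f => f [[f1] [f2]]; case: g => g [[g1] [g2]] /= fg.
have {}fg : f = g by exact: funext.
case: _ / fg in g1 g2 *.
by rewrite (Prop_irrelevance f1 g1) (Prop_irrelevance f2 g2).
Qed.

Section SweedlerTheory.
Variable k : fieldType.

Lemma sweedler_sweedler (U V U' V' W : lmodType k) (t : U ⊗ V)
    (F : U -> V -> U' ⊗ V') (f : U' -> V' -> W) : isbilin f ->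
  sweedler (sweedler t F) f = \sw_(u, v <- t) sweedler (F u v) f.
Proof. by move=> bf; exact: (lin_sweedler _ _ (sweedler_linear bf)). Qed.

Definition trilin (U V X W : lmodType k) (F : U -> V -> X -> W) :=
  (forall v x, islin (fun u => F u v x)) /\ (forall u, isbilin (F u)).

Lemma sweedler3 (U V X W : lmodType k) (F : U -> V -> X -> W) u v x : trilin F ->
  \sw_(a, y <- u ⊗ (v ⊗ x)) \sw_(b, c <- y) F a b c = F u v x.
Proof.
move=> [F1 F2].
have bF a : isbilin (fun y z => F a y z) by exact: F2.
rewrite sweedler_tens ?sweedler_tens //; split=> [y|a].
  by apply: islin_sweedlerf => v' x'; exact: F1.
by exact: sweedler_linear.
Qed.

Lemma sweedler3_linear (U V X W : lmodType k) (F : U -> V -> X -> W) : trilin F ->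
  islin (fun t : U ⊗ (V ⊗ X) => \sw_(a, y <- t) \sw_(b, c <- y) F a b c).
Proof.
move=> [F1 F2]; apply: sweedler_linear; split=> [y|a].
  by apply: islin_sweedlerf => v' x'; exact: F1.
by apply: sweedler_linear; exact: F2.
Qed.

Lemma hc_coassocF (C : homHopf k) (W : lmodType k) (F : C -> C -> C -> W) (c : C) :
  trilin F ->
  \sw_(c1, c2 <- comul c) \sw_(c21, c22 <- comul c2) F (hmap c1) c21 c22 =
  \sw_(c1, c2 <- comul c) \sw_(c11, c12 <- comul c1) F c11 c12 (hmap c2).
Proof.
move=> tF.
have := congr1 (fun t => \sw_(a, y <- t) \sw_(b, d <- y) F a b d)
  (hc_coassoc (hh_coalgebra C) c).
rewrite !(lin_sweedler _ _ (sweedler3_linear tF)).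
under eq_sweedler => c1 c2.
  rewrite (lin_sweedler _ _ (sweedler3_linear tF)).
  under eq_sweedler do rewrite sweedler3 //.
  over.
move=> ->; apply: eq_sweedler => c1 c2.
rewrite (lin_sweedler _ _ (sweedler3_linear tF)).
by apply: eq_sweedler => ? ?; rewrite sweedler3.
Qed.

Lemma comul_mapF (C : homHopf k) (W : lmodType k) (F : C -> C -> W) (c : C) :
  isbilin F ->
  sweedler (comul (hmap c)) F = \sw_(c1, c2 <- comul c) F (hmap c1) (hmap c2).
Proof.
move=> bF; rewrite (hc_map_comul (hh_coalgebra C)) sweedler_sweedler //.
by apply: eq_sweedler => c1 c2; rewrite sweedler_tens.
Qed.

Lemma isbilin_comp (U V U' V' W : lmodType k) (F : U -> V -> W) (f : U' -> U)
  (g : V' -> V) : isbilin F -> islin f -> islin g ->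
  isbilin (fun x y => F (f x) (g y)).
Proof.
move=> [F1 F2] lf lg; split=> [y|x].
  exact: (islin_comp (F1 (g y)) lf).
exact: (islin_comp (F2 (f x)) lg).
Qed.

Lemma comul_invF (C : homHopf k) (W : lmodType k) (F : C -> C -> W) (c : C) :
  isbilin F ->
  sweedler (comul (auto_inv hmap c)) F =
  \sw_(c1, c2 <- comul c) F (auto_inv hmap c1) (auto_inv hmap c2).
Proof.
move=> bF; rewrite -[in RHS](auto_invK hmap c) comul_mapF.
  by apply: eq_sweedler => c1 c2; rewrite !auto_funK.
by apply: isbilin_comp => //; exact: islin_inv.
Qed.

Lemma comul_mulF (C : homHopf k) (W : lmodType k) (F : C -> C -> W) (b c : C) :
  isbilin F ->
  sweedler (comul (b ∗ c)) F =
  \sw_(b1, b2 <- comul b) \sw_(c1, c2 <- comul c) F (b1 ∗ c1) (b2 ∗ c2).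
Proof.
move=> bF; rewrite hh_comulM sweedler_sweedler //.
apply: eq_sweedler => b1 b2; rewrite sweedler_sweedler //.
by apply: eq_sweedler => c1 c2; rewrite sweedler_tens.
Qed.

Lemma hmap_mul (C : homHopf k) (b c : C) : hmap (b ∗ c) = hmap b ∗ hmap c.
Proof. exact: (ha_mapM (hh_algebra C)). Qed.

Lemma hinv_mul (C : homHopf k) (b c : C) :
  auto_inv hmap (b ∗ c) = auto_inv hmap b ∗ auto_inv hmap c.
Proof. by apply: (can_inj (auto_funK hmap)); rewrite hmap_mul !auto_invK. Qed.

Lemma counit_inv (C : homHopf k) (c : C) : counit (auto_inv hmap c) = counit c.
Proof. by rewrite -[in RHS](auto_invK hmap c) (hc_map_counit (hh_coalgebra C)). Qed.

Section Tmap.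
Variables U V U' V' : lmodType k.

Lemma tmap_islin (f : {linear U -> U'}) (g : {linear V -> V'}) :
  islin (fun t => \sw_(u, v <- t) (f u ⊗ g v)).
Proof. by lin. Qed.

Definition tmap f g : {linear (U ⊗ V)%type -> (U' ⊗ V')%type} :=
  mklin (tmap_islin f g).

Lemma tmapE f g u v : tmap f g (u ⊗ v) = f u ⊗ g v.
Proof. by rewrite /tmap /= sweedler_tens //; lin. Qed.

End Tmap.

Section TensAuto.
Variables (U V : lmodType k) (f : lin_auto U) (g : lin_auto V).

Let tinv := fun t : U ⊗ V => \sw_(u, v <- t) (auto_inv f u ⊗ auto_inv g v).

Let tinv_lin : islin tinv. Proof. by rewrite /tinv; lin. Qed.

Let tinvE u v : tinv (u ⊗ v) = auto_inv f u ⊗ auto_inv g v.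
Proof. by rewrite /tinv sweedler_tens //; lin. Qed.

Lemma tens_autoK : cancel (tmap f g) tinv.
Proof.
apply: tens_lin_eq => //; last by move=> u v; rewrite tmapE tinvE !auto_funK.
by apply: islin_comp tinv_lin _; lin.
Qed.

Lemma tens_auto_invK : cancel tinv (tmap f g).
Proof.
apply: tens_lin_eq => //; last by move=> u v; rewrite tinvE tmapE !auto_invK.
by apply: islin_comp _ tinv_lin; lin.
Qed.

Definition tens_auto : lin_auto (U ⊗ V)%type := LinAuto tens_autoK tens_auto_invK.

Lemma tens_autoE u v : tens_auto (u ⊗ v) = f u ⊗ g v.
Proof. exact: tmapE. Qed.

End TensAuto.
End SweedlerTheory.

Section LongTensor.
Variables (k : fieldType) (H B : homHopf k).
Local Notation Long := (longDimodule H B).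

Lemma coact_coassocF (M : Long) (W : lmodType k) (F : B -> B -> M -> W) (m : M) :
  trilin F ->
  \sw_(b, m0 <- coact m) \sw_(b', m00 <- coact m0) F (hmap b) b' m00 =
  \sw_(b, m0 <- coact m) \sw_(b1, b2 <- comul b) F b1 b2 (ld_map m0).
Proof.
move=> tF.
have := congr1 (fun t => \sw_(a, y <- t) \sw_(b, d <- y) F a b d)
  (hcm_coassoc (ld_comodule M) m).
rewrite !(lin_sweedler _ _ (sweedler3_linear tF)).
under eq_sweedler => c1 c2.
  rewrite (lin_sweedler _ _ (sweedler3_linear tF)).
  under eq_sweedler do rewrite sweedler3 //.
  over.
move=> ->; apply: eq_sweedler => c1 c2.
rewrite (lin_sweedler _ _ (sweedler3_linear tF)).
by apply: eq_sweedler => ? ?; rewrite sweedler3.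
Qed.

Lemma coact_mapF (M : Long) (W : lmodType k) (F : B -> M -> W) (m : M) : isbilin F ->
  sweedler (coact (ld_map m)) F = \sw_(b, m0 <- coact m) F (hmap b) (ld_map m0).
Proof.
move=> bF; rewrite (hcm_map (ld_comodule M)) sweedler_sweedler //.
by apply: eq_sweedler => c1 c2; rewrite sweedler_tens.
Qed.

Lemma coact_actF (M : Long) (W : lmodType k) (F : B -> M -> W) h (m : M) :
  isbilin F ->
  sweedler (coact (h ▹ m)) F = \sw_(b, m0 <- coact m) F (hmap b) (hmap h ▹ m0).
Proof.
move=> bF; rewrite ld_compat sweedler_sweedler //.
by apply: eq_sweedler => c1 c2; rewrite sweedler_tens.
Qed.

Section TensorObject.
Variables M N : Long.

Lemma tens_act_islin : islin (fun x : H ⊗ (M ⊗ N) =>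
  \sw_(h, t <- x) \sw_(h1, h2 <- comul h) \sw_(m, n <- t) ((h1 ▹ m) ⊗ (h2 ▹ n))).
Proof. by lin. Qed.

Definition tens_act : {linear (H ⊗ (M ⊗ N))%type -> (M ⊗ N)%type} :=
  mklin tens_act_islin.

Lemma tens_actE h m n : tens_act (h ⊗ (m ⊗ n)) =
  \sw_(h1, h2 <- comul h) ((h1 ▹ m) ⊗ (h2 ▹ n)).
Proof.
rewrite /tens_act /= sweedler_tens; last by lin.
by apply: eq_sweedler => h1 h2; rewrite sweedler_tens //; lin.
Qed.

Lemma tens_coact_islin : islin (fun t : M ⊗ N =>
  \sw_(m, n <- t) \sw_(b, m0 <- coact m) \sw_(c, n0 <- coact n)
    (auto_inv hmap (auto_inv hmap (b ∗ c)) ⊗ (m0 ⊗ n0))).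
Proof. by lin. Qed.

Definition tens_coact : {linear (M ⊗ N)%type -> (B ⊗ (M ⊗ N))%type} :=
  mklin tens_coact_islin.

Lemma tens_coactE m n : tens_coact (m ⊗ n) =
  \sw_(b, m0 <- coact m) \sw_(c, n0 <- coact n)
    (auto_inv hmap (auto_inv hmap (b ∗ c)) ⊗ (m0 ⊗ n0)).
Proof. by rewrite /tens_coact /= sweedler_tens //; lin. Qed.

Lemma tens_coactF (W : lmodType k) (F : B -> M ⊗ N -> W) m n : isbilin F ->
  sweedler (tens_coact (m ⊗ n)) F =
  \sw_(b, m0 <- coact m) \sw_(c, n0 <- coact n)
    F (auto_inv hmap (auto_inv hmap (b ∗ c))) (m0 ⊗ n0).
Proof.
move=> bF; rewrite tens_coactE sweedler_sweedler //.
apply: eq_sweedler => b m0; rewrite sweedler_sweedler //.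
by apply: eq_sweedler => c n0; rewrite sweedler_tens.
Qed.

Lemma tens_module : is_hom_module tens_act (tens_auto (ld_map (l := M)) (ld_map (l := N))).
Proof.
split.
- move=> h; apply: tens_lin_eq; [by lin..|] => m n.
  rewrite !tens_autoE !tens_actE (lin_sweedler (g := tens_auto ld_map ld_map)); last by lin.
  rewrite comul_mapF; last by lin.
  apply: eq_sweedler => h1 h2; rewrite tens_autoE.
  by rewrite (hm_map (ld_module M)) (hm_map (ld_module N)).
- move=> h h'; apply: tens_lin_eq; [by lin..|] => m n.
  rewrite !tens_autoE !tens_actE.
  rewrite [LHS](_ : _ = \sw_(h1, h2 <- comul h') tens_act (hmap h ⊗ (h1 ▹ m ⊗ (h2 ▹ n)))).
    rewrite comul_mulF; last by lin.
    rewrite exchange_sweedler; apply: eq_sweedler => h1 h2.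
    rewrite tens_actE comul_mapF; last by lin.
    apply: eq_sweedler => g1 g2.
    by rewrite (hm_assoc (ld_module M)) (hm_assoc (ld_module N)).
  by apply: (lin_sweedler (g := fun t => tens_act (hmap h ⊗ t))); lin.
- apply: tens_lin_eq; [by lin..|] => m n.
  rewrite tens_autoE tens_actE hh_comul1 sweedler_tens; last by lin.
  by rewrite (hm_unit (ld_module M)) (hm_unit (ld_module N)).
Qed.

Lemma tens_comodule : is_hom_comodule tens_coact (tens_auto (ld_map (l := M)) (ld_map (l := N))).
Proof.
split.
- apply: tens_lin_eq; [by lin..|] => m n.
  rewrite tens_coactF; last by lin.
  rewrite tens_autoE tens_coactE coact_mapF; last by lin.
  apply: eq_sweedler => b m0; rewrite coact_mapF; last by lin.
  apply: eq_sweedler => c n0; rewrite tens_autoE -hmap_mul.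
  by rewrite auto_funK auto_invK.
- apply: tens_lin_eq; [by lin..|] => m n.
  rewrite tens_coactF; last by lin.
  rewrite tens_autoE -(hcm_counit (ld_comodule M)) -(hcm_counit (ld_comodule N)).
  rewrite (lin_sweedler (g := fun t => t ⊗ _)); last by lin.
  apply: eq_sweedler => b m0.
  rewrite (lin_sweedler (g := fun t => _ ⊗ t)); last by lin.
  apply: eq_sweedler => c n0.
  by rewrite !counit_inv hh_counitM tensZl tensZr scalerA.
- apply: tens_lin_eq; [by lin..|] => m n.
  rewrite !tens_coactF; try by lin.
  pose G x y z x' y' z' : B ⊗ (B ⊗ (M ⊗ N)) :=
    auto_inv hmap (auto_inv hmap (x ∗ x')) ⊗
    (auto_inv hmap (auto_inv hmap (y ∗ y')) ⊗ (z ⊗ z')).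
  transitivity (\sw_(b, m0 <- coact m) \sw_(b', m00 <- coact m0)
    \sw_(c, n0 <- coact n) \sw_(c', n00 <- coact n0)
      G (hmap b) b' m00 (hmap c) c' n00).
    apply: eq_sweedler => b m0; rewrite [RHS]exchange_sweedler.
    apply: eq_sweedler => c n0; rewrite tens_coactF; last by lin.
    apply: eq_sweedler => b' m00; apply: eq_sweedler => c' n00.
    by rewrite /G -hmap_mul auto_invK auto_funK.
  rewrite (coact_coassocF (F := fun x y z => \sw_(c, n0 <- coact n)
    \sw_(c', n00 <- coact n0) G x y z (hmap c) c' n00)); last first.
    by rewrite /G; split=> [v x|u]; lin.
  apply: eq_sweedler => b m0.
  transitivity (\sw_(b1, b2 <- comul b) \sw_(c, n0 <- coact n)
     \sw_(c1, c2 <- comul c) G b1 b2 (ld_map m0) c1 c2 (ld_map n0)).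
    apply: eq_sweedler => b1 b2.
    apply: (coact_coassocF (F := fun x y z => G b1 b2 (ld_map m0) x y z)).
    by rewrite /G; split=> [v x|u]; lin.
  rewrite exchange_sweedler; apply: eq_sweedler => c n0.
  rewrite comul_invF; last by lin.
  rewrite comul_invF; last by lin.
  rewrite comul_mulF; last by lin.
  by apply: eq_sweedler => b1 b2; apply: eq_sweedler => c1 c2; rewrite tens_autoE.
Qed.

Lemma tens_compat h t : tens_coact (tens_act (h ⊗ t)) =
  \sw_(b, t0 <- tens_coact t) (hmap b ⊗ tens_act (hmap h ⊗ t0)).
Proof.
move: t; apply: tens_lin_eq; [by lin..|] => m n.
rewrite tens_coactF; last by lin.
rewrite tens_actE lin_sweedler; last by lin.
under eq_sweedler => h1 h2.
  rewrite tens_coactE coact_actF; last by lin.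
  over.
rewrite [LHS]exchange_sweedler; apply: eq_sweedler => b m0.
under eq_sweedler => h1 h2.
  rewrite coact_actF; last by lin.
  over.
rewrite [LHS]exchange_sweedler; apply: eq_sweedler => c n0.
rewrite tens_actE comul_mapF; last by lin.
rewrite (lin_sweedler (g := fun t => hmap _ ⊗ t)); last by lin.
by apply: eq_sweedler => h1 h2; rewrite -hmap_mul auto_funK auto_invK.
Qed.

Definition long_tensor : Long := LongDimodule tens_module tens_comodule tens_compat.

End TensorObject.

Definition id_auto (V : lmodType k) : lin_auto V :=
  @LinAuto k V idfun idfun (fun=> erefl) (fun=> erefl).

Lemma unit_act_islin :
  islin (fun x : H ⊗ k^o => \sw_(h, a <- x) ((counit h * a) : k^o)).
Proof.
apply: sweedler_linear; split=> [a|h] c x y.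
  by rewrite linearP mulrDl scalerAl.
by rewrite mulrDr scalerAr.
Qed.

Definition unit_act : {linear (H ⊗ k^o)%type -> k^o} := mklin unit_act_islin.

Lemma unit_actE h a : unit_act (h ⊗ a) = counit h * a.
Proof.
rewrite /unit_act /= sweedler_tens //; split=> [c|g] b x y.
  by rewrite linearP mulrDl scalerAl.
by rewrite mulrDr scalerAr.
Qed.

Lemma unit_coact_islin : islin (fun a : k^o => hone B ⊗ a).
Proof. by lin. Qed.

Definition unit_coact : {linear k^o -> (B ⊗ k^o)%type} := mklin unit_coact_islin.

Lemma unit_coactE a : unit_coact a = hone B ⊗ a.
Proof. by []. Qed.

Lemma unit_module : is_hom_module unit_act (id_auto k^o).
Proof.
split=> [h m|h h' m|m]; rewrite !unit_actE.
- by rewrite (hc_map_counit (hh_coalgebra H)).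
- by rewrite (hc_map_counit (hh_coalgebra H)) hh_counitM mulrA.
- by rewrite hh_counit1 mul1r.
Qed.

Lemma unit_comodule : is_hom_comodule unit_coact (id_auto k^o).
Proof.
split=> m; rewrite !unit_coactE !sweedler_tens; try by lin.
- by rewrite (ha_map1 (hh_algebra B)).
- by rewrite hh_counit1 scale1r.
- by rewrite (ha_map1 (hh_algebra B)) hh_comul1 sweedler_tens //; lin.
Qed.

Lemma unit_compat h m : unit_coact (unit_act (h ⊗ m)) =
  \sw_(b, m0 <- unit_coact m) (hmap b ⊗ unit_act (hmap h ⊗ m0)).
Proof.
rewrite !unit_coactE sweedler_tens; last by lin.
by rewrite !unit_actE (hc_map_counit (hh_coalgebra H)) (ha_map1 (hh_algebra B)).
Qed.

Definition long_unit : Long := LongDimodule unit_module unit_comodule unit_compat.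

End LongTensor.


Record category := Category {
  cat_ob :> Type;
  cat_hom : cat_ob -> cat_ob -> Type;
  idm : forall X, cat_hom X X;
  compm : forall X Y Z, cat_hom Y Z -> cat_hom X Y -> cat_hom X Z;
  compm1 : forall X Y (f : cat_hom X Y), compm f (idm X) = f;
  comp1m : forall X Y (f : cat_hom X Y), compm (idm Y) f = f;
  compmA : forall X Y Z T (h : cat_hom Z T) (g : cat_hom Y Z) (f : cat_hom X Y),
    compm h (compm g f) = compm (compm h g) f }.

Arguments cat_hom {c} X Y.
Arguments idm {c} X.
Arguments compm {c X Y Z} g f.
Notation "g ∘m f" := (compm g f) (at level 50, left associativity).

Definition is_iso (C : category) (X Y : C) (f : cat_hom X Y) : Prop :=
  exists g : cat_hom Y X, g ∘m f = idm X /\ f ∘m g = idm Y.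

(** Monoidal structures with given tensor product of objects and unit. *)
Record monoidal (C : category) (T : C -> C -> C) (I : C) := Monoidal {
  mtens : forall X X' Y Y', cat_hom X X' -> cat_hom Y Y' -> cat_hom (T X Y) (T X' Y');
  massoc : forall X Y Z, cat_hom (T (T X Y) Z) (T X (T Y Z));
  massoc_inv : forall X Y Z, cat_hom (T X (T Y Z)) (T (T X Y) Z);
  mlunit : forall X, cat_hom (T I X) X;
  mrunit : forall X, cat_hom (T X I) X;
  mtens_id : forall X Y, mtens (idm X) (idm Y) = idm (T X Y);
  mtens_comp : forall X X' X'' Y Y' Y'' (f' : cat_hom X' X'') (f : cat_hom X X')
      (g' : cat_hom Y' Y'') (g : cat_hom Y Y'),
    mtens (f' ∘m f) (g' ∘m g) = mtens f' g' ∘m mtens f g;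
  massocK : forall X Y Z, massoc_inv X Y Z ∘m massoc X Y Z = idm _;
  massoc_invK : forall X Y Z, massoc X Y Z ∘m massoc_inv X Y Z = idm _;
  mlunit_iso : forall X, is_iso (mlunit X);
  mrunit_iso : forall X, is_iso (mrunit X);
  massoc_nat : forall X X' Y Y' Z Z' (f : cat_hom X X') (g : cat_hom Y Y') (h : cat_hom Z Z'),
    massoc X' Y' Z' ∘m mtens (mtens f g) h = mtens f (mtens g h) ∘m massoc X Y Z;
  mlunit_nat : forall X X' (f : cat_hom X X'),
    mlunit X' ∘m mtens (idm I) f = f ∘m mlunit X;
  mrunit_nat : forall X X' (f : cat_hom X X'),
    mrunit X' ∘m mtens f (idm I) = f ∘m mrunit X;
  mtriangle : forall X Y,
    mtens (idm X) (mlunit Y) ∘m massoc X I Y = mtens (mrunit X) (idm Y);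
  mpentagon : forall X Y Z W,
    massoc X Y (T Z W) ∘m massoc (T X Y) Z W =
    mtens (idm X) (massoc Y Z W) ∘m massoc X (T Y Z) W
      ∘m mtens (massoc X Y Z) (idm W) }.

Arguments mtens {C T I} S {X X' Y Y'} f g : rename.
Arguments massoc {C T I} S X Y Z : rename.
Arguments massoc_inv {C T I} S X Y Z : rename.
Arguments mlunit {C T I} S X : rename.
Arguments mrunit {C T I} S X : rename.

Record is_braiding (C : category) (T : C -> C -> C) (I : C) (S : monoidal T I)
    (c : forall X Y, cat_hom (T X Y) (T Y X)) : Prop := IsBraiding {
  braid_iso : forall X Y, is_iso (c X Y);
  braid_nat : forall X X' Y Y' (f : cat_hom X X') (g : cat_hom Y Y'),
    c X' Y' ∘m mtens S f g = mtens S g f ∘m c X Y;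
  braid_hexagonl : forall X Y Z,
    massoc S Y Z X ∘m c X (T Y Z) ∘m massoc S X Y Z =
    mtens S (idm Y) (c X Z) ∘m massoc S Y X Z ∘m mtens S (c X Y) (idm Z);
  braid_hexagonr : forall X Y Z,
    massoc_inv S Z X Y ∘m c (T X Y) Z ∘m massoc_inv S X Y Z =
    mtens S (c X Z) (idm Y) ∘m massoc_inv S X Z Y ∘m mtens S (idm X) (c Y Z) }.

Section LongCategory.
Variables (k : fieldType) (H B : homHopf k).
Local Notation Long := (longDimodule H B).

Lemma longHom_eq (M N : Long) (f g : longHom M N) : (forall m, f m = g m) -> f = g.
Proof.
case: f => f f1 f2 f3; case: g => g g1 g2 g3 /= fg.
have {}fg : f = g by exact: linear_eq.
case: _ / fg in g1 g2 g3 *.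
by congr LongHom; exact: Prop_irrelevance.
Qed.

Definition long_id (M : Long) : longHom M M.
Proof.
by refine (@LongHom k H B M M idfun _ _ _) => // m; rewrite /= sweedlerE.
Defined.

Definition long_comp (M N P : Long) (g : longHom N P) (f : longHom M N) :
  longHom M P.
Proof.
refine (@LongHom k H B M P (g \o f) _ _ _) => [h m|m|m] /=.
- by rewrite !lh_act.
- rewrite lh_coact lh_coact sweedler_sweedler; last by lin.
  by apply: eq_sweedler => b m0; rewrite sweedler_tens //; lin.
- by rewrite !lh_map.
Defined.

Definition long_category : category.
Proof.
by refine (@Category Long (@longHom k H B) long_id long_comp _ _ _) => *;
  exact: longHom_eq.
Defined.

End LongCategory.

(* Main.v *)
(** The structure maps [alpha], [beta] and those of the dimodules commute with
    everything, [R] and the form being invariant under them, so the classical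
    computations apply once the twists are tracked.  The associator is natural and
    coherent because Hom-(co)associativity shifts exactly one power of the structure
    maps from the first to the last factor.  The braiding is H-linear by the
    commutation rule of [R], colinear by that of the form, and its hexagons are the
    two coproduct formulas for [R] combined with the multiplicativity of the form in
    each argument.  Its inverse replaces [R] by [(S ⊗ id) R] and the form by
    [form \o (id ⊗ S)]; a bijective morphism of dimodules has an inverse morphism,
    so only bijectivity has to be checked. *)

Require Import Defs.
From HB Require Import structures.
From mathcomp Require Import all_boot all_algebra.

Set Implicit Arguments.
Unset Strict Implicit.
Unset Printing Implicit Defensive.

Import GRing.Theory.
Local Open Scope ring_scope.

(** * Linear algebra of twofold and threefold tensors *)

Section LinearAlgebra.
Variable k : fieldType.

Lemma scaler_sweedler (U V W : lmodType k) a (t : U ⊗ V) (f : U -> V -> W) :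
  a *: sweedler t f = \sw_(u, v <- t) (a *: f u v).
Proof. by apply: (lin_sweedler (g := fun x => a *: x)); lin. Qed.

Lemma linZ (U V : lmodType k) (f : {linear U -> V}) a x : f (a *: x) = a *: f x.
Proof. exact: linearZ. Qed.

Lemma islin_can (U V : lmodType k) (f : {linear U -> V}) (g : V -> U) :
  cancel f g -> cancel g f -> islin g.
Proof. by move=> fK gK a x y; apply: (can_inj fK); rewrite linearP !gK. Qed.

Lemma tens3_lin_eq (U V W X : lmodType k) (f g : (U ⊗ V) ⊗ W -> X) :
  islin f -> islin g ->
  (forall u v w, f ((u ⊗ v) ⊗ w) = g ((u ⊗ v) ⊗ w)) -> forall t, f t = g t.
Proof.
move=> lf lg fg; apply: tens_lin_eq => // t w; move: t.
by apply: tens_lin_eq => //;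
  [apply: (islin_comp (g := fun x => x ⊗ w)) lf _
  |apply: (islin_comp (g := fun x => x ⊗ w)) lg _]; lin.
Qed.

Lemma tens3r_lin_eq (U V W X : lmodType k) (f g : U ⊗ (V ⊗ W) -> X) :
  islin f -> islin g ->
  (forall u v w, f (u ⊗ (v ⊗ w)) = g (u ⊗ (v ⊗ w))) -> forall t, f t = g t.
Proof.
move=> lf lg fg; apply: tens_lin_eq => // u.
by apply: tens_lin_eq => //;
  [apply: (islin_comp (g := fun x => u ⊗ x)) lf _
  |apply: (islin_comp (g := fun x => u ⊗ x)) lg _]; lin.
Qed.

Lemma sweedler3_sw (A C D U V W : lmodType k) (t : A ⊗ C)
    (G : A -> C -> U ⊗ (V ⊗ D)) (F : U -> V -> D -> W) : trilin F ->
  \sw_(a, y <- sweedler t G) \sw_(b, c <- y) F a b c =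
  \sw_(x, z <- t) \sw_(a, y <- G x z) \sw_(b, c <- y) F a b c.
Proof. by move=> tF; exact: (lin_sweedler _ _ (sweedler3_linear tF)). Qed.

Lemma tens_auto_invE (U V : lmodType k) (f : lin_auto U)
    (g : lin_auto V) u v :
  auto_inv (tens_auto f g) (u ⊗ v) = auto_inv f u ⊗ auto_inv g v.
Proof.
apply: (can_inj (auto_funK (tens_auto f g))).
by rewrite auto_invK tens_autoE !auto_invK.
Qed.

Lemma hmap1 (A : homHopf k) : hmap (hone A) = hone A.
Proof. exact: (ha_map1 (hh_algebra A)). Qed.

Lemma hinv1 (A : homHopf k) : auto_inv hmap (hone A) = hone A.
Proof. by rewrite -[in LHS]hmap1 auto_funK. Qed.

Lemma antipode_inv (A : homHopf k) (a : A) :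
  antipode (auto_inv hmap a) = auto_inv hmap (antipode a).
Proof. by apply: (can_inj (auto_funK hmap)); rewrite -hh_antipode_map !auto_invK. Qed.

End LinearAlgebra.

(** * The monoidal category of Long dimodules *)

Section Dimodules.
Variables (k : fieldType) (H B : homHopf k).
Local Notation Long := (longDimodule H B).

Lemma act_map (M : Long) h (m : M) : ld_map (h ▹ m) = hmap h ▹ ld_map m.
Proof. exact: (hm_map (ld_module M)). Qed.

Lemma act_inv (M : Long) h (m : M) :
  auto_inv ld_map (h ▹ m) = auto_inv hmap h ▹ auto_inv ld_map m.
Proof. by apply: (can_inj (auto_funK ld_map)); rewrite act_map !auto_invK. Qed.

(** Hom-associativity of the action, solved for an arbitrary outer scalar. It collapses nested
    actions to a single one, which is the normal form used when comparing the two sides of the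
    braiding identities. *)
Lemma act_act (M : Long) h g (m : M) :
  h ▹ (g ▹ m) = (auto_inv hmap h ∗ g) ▹ ld_map m.
Proof. by rewrite -(hm_assoc (ld_module M)) auto_invK. Qed.

Lemma act1 (M : Long) (m : M) : hone H ▹ m = ld_map m.
Proof. exact: (hm_unit (ld_module M)). Qed.

Lemma coact_invF (M : Long) (W : lmodType k) (F : B -> M -> W) (m : M) : isbilin F ->
  sweedler (coact (auto_inv ld_map m)) F =
  \sw_(b, m0 <- coact m) F (auto_inv hmap b) (auto_inv ld_map m0).
Proof.
move=> bF; rewrite -[in RHS](auto_invK ld_map m) coact_mapF.
  by apply: eq_sweedler => b m0; rewrite !auto_funK.
by apply: isbilin_comp => //; exact: islin_inv.
Qed.

(** Iterated braidings produce two successive coactions with no twist on the first one, whereas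
    Hom-coassociativity carries [hmap] there. Precomposing the first argument with the inverse twist
    moves it to the coproduct side. *)
Lemma coact_coassoc_invF (M : Long) (W : lmodType k) (F : B -> B -> M -> W) (m : M) :
  trilin F ->
  \sw_(b, m0 <- coact m) \sw_(b', m00 <- coact m0) F b b' m00 =
  \sw_(b, m0 <- coact m) \sw_(b1, b2 <- comul b) F (auto_inv hmap b1) b2 (ld_map m0).
Proof.
move=> [F1 F2].
rewrite -(coact_coassocF (F := fun x y z => F (auto_inv hmap x) y z)).
  by apply: eq_sweedler => b m0; apply: eq_sweedler => b' m00; rewrite auto_funK.
split=> [v x|u]; last exact: F2.
exact: (islin_comp (F1 v x) (@islin_inv _ _ _)).
Qed.

Lemma coact_counit (M : Long) (m : M) :
  \sw_(b, m0 <- coact m) (counit b *: auto_inv ld_map m0) = m.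
Proof.
rewrite -[RHS](auto_funK ld_map) -(hcm_counit (ld_comodule M)).
rewrite (lin_sweedler (g := auto_inv ld_map)); last exact: islin_inv.
by apply: eq_sweedler => b m0; rewrite (islinZ _ _ (@islin_inv _ _ _)).
Qed.

(** * Bijective morphisms of dimodules are isomorphisms *)

Section Inverse.
Variables (M N : Long) (f : longHom M N) (g : N -> M).
Hypotheses (fK : cancel f g) (gK : cancel g f).

Let g' : {linear N -> M} := mklin (islin_can fK gK).

Definition longHom_inv : longHom N M.
Proof.
refine (@LongHom k H B N M g' _ _ _) => [h n|n|n] /=.
- by apply: (can_inj fK); rewrite lh_act !gK.
(* Colinearity of the inverse is checked after applying [id ⊗ f], which is injective with left
   inverse [id ⊗ g']. Colinearity of [f] then makes both sides equal to [coact n]. *)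
- apply: (can_inj (g := fun t => \sw_(b, m <- t) (b ⊗ g' m))
    (f := fun t => \sw_(b, m <- t) (b ⊗ f m))).
    apply: tens_lin_eq; [by lin..|] => b m.
    rewrite sweedler_tens; last by lin.
    rewrite sweedler_tens; last by lin.
    by congr (_ ⊗ _); exact: fK.
  rewrite -lh_coact gK sweedler_sweedler; last by lin.
  rewrite -[LHS]sweedlerE; apply: eq_sweedler => b n0.
  rewrite sweedler_tens; last by lin.
  by congr (_ ⊗ _); rewrite -[LHS]gK.
- by apply: (can_inj fK); rewrite lh_map !gK.
Defined.

Lemma longHom_inv_iso : @is_iso (long_category H B) M N f.
Proof.
exists (longHom_inv : @cat_hom (long_category H B) _ _).
by split; apply: longHom_eq => x /=.
Qed.

End Inverse.

(** * Tensor products of morphisms *)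

Section TensorHom.
Variables (M M' N N' : Long) (f : longHom M M') (g : longHom N N').

Definition long_tmap : longHom (long_tensor M N) (long_tensor M' N').
Proof.
refine (@LongHom k H B (long_tensor M N) (long_tensor M' N') (tmap f g) _ _ _)
  => [h|x|x].
- apply: tens_lin_eq; [by lin..|] => m n.
  rewrite tmapE !tens_actE lin_sweedler; last by lin.
  by apply: eq_sweedler => h1 h2; rewrite tmapE !lh_act.
- move: x; apply: tens_lin_eq; [by lin..|] => m n.
  rewrite tmapE tens_coactE tens_coactF; last by lin.
  rewrite lh_coact sweedler_sweedler; last by lin.
  apply: eq_sweedler => b m0; rewrite sweedler_tens; last by lin.
  rewrite lh_coact sweedler_sweedler; last by lin.
  by apply: eq_sweedler => c n0; rewrite sweedler_tens ?tmapE //; lin.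
- move: x; apply: tens_lin_eq; [by lin..|] => m n.
  by rewrite !(tmapE, tens_autoE) !lh_map.
Defined.

Lemma long_tmapE m n : long_tmap (m ⊗ n) = f m ⊗ g n.
Proof. exact: tmapE. Qed.

End TensorHom.

(** * The associator *)

Section Associator.
Variables U V W : Long.

Lemma assoc_islin : islin (fun t : (U ⊗ V) ⊗ W =>
  \sw_(x, w <- t) \sw_(u, v <- x) (auto_inv ld_map u ⊗ (v ⊗ ld_map w))).
Proof. by lin. Qed.

Definition assoc_lin : {linear (U ⊗ V ⊗ W)%type -> (U ⊗ (V ⊗ W))%type} :=
  mklin assoc_islin.

Lemma assoc_linE u v w :
  assoc_lin ((u ⊗ v) ⊗ w) = auto_inv ld_map u ⊗ (v ⊗ ld_map w).
Proof.
rewrite /assoc_lin /= sweedler_tens; last by lin.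
by rewrite sweedler_tens //; lin.
Qed.

Definition assoc_inv (t : U ⊗ (V ⊗ W)) : U ⊗ V ⊗ W :=
  \sw_(u, x <- t) \sw_(v, w <- x) ((ld_map u ⊗ v) ⊗ auto_inv ld_map w).

Lemma assoc_invE u v w :
  assoc_inv (u ⊗ (v ⊗ w)) = (ld_map u ⊗ v) ⊗ auto_inv ld_map w.
Proof.
rewrite /assoc_inv sweedler_tens; last by lin.
by rewrite sweedler_tens //; lin.
Qed.

Lemma assoc_inv_islin : islin assoc_inv.
Proof. by rewrite /assoc_inv; lin. Qed.

Lemma assoc_linK : cancel assoc_lin assoc_inv.
Proof.
apply: tens3_lin_eq; [|by lin|].
  by apply: islin_comp; [exact: assoc_inv_islin|exact: islin_linear].
by move=> u v w; rewrite assoc_linE assoc_invE auto_invK auto_funK.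
Qed.

Lemma assoc_invK : cancel assoc_inv assoc_lin.
Proof.
apply: tens3r_lin_eq; [|by lin|].
  by apply: islin_comp; [exact: islin_linear|exact: assoc_inv_islin].
by move=> u v w; rewrite assoc_invE assoc_linE auto_invK auto_funK.
Qed.

Definition long_assoc : longHom (long_tensor (long_tensor U V) W)
  (long_tensor U (long_tensor V W)).
Proof.
refine (@LongHom k H B (long_tensor (long_tensor U V) W)
  (long_tensor U (long_tensor V W)) assoc_lin _ _ _) => [h|x|x].
- apply: tens3_lin_eq; [by lin..|] => u v w.
  rewrite assoc_linE (@tens_actE k H B (long_tensor U V) W).
  rewrite (@tens_actE k H B U (long_tensor V W)) lin_sweedler; last by lin.
  under eq_sweedler => h1 h2.
    rewrite tens_actE (lin_sweedler (g := fun t => t ⊗ _)); last by lin.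
    rewrite lin_sweedler; last by lin.
    under eq_sweedler => h11 h12 do rewrite assoc_linE act_inv act_map.
    over.
  (* The associator leaves the inverse twist on [h11] and the twist on [h2]. Absorbing the former
     into the trilinear map gives exactly the twisted side of Hom-coassociativity in [H]. *)
  rewrite -(hc_coassocF (F := fun x y z =>
    (auto_inv hmap x ▹ auto_inv ld_map u) ⊗ ((y ▹ v) ⊗ (z ▹ ld_map w)))).
    apply: eq_sweedler => h1 h2; rewrite auto_funK tens_actE.
    by rewrite (lin_sweedler (g := fun t => _ ⊗ t)); last by lin.
  by split=> [v' x|u']; lin.
- move: x; apply: tens3_lin_eq; [by lin..|] => u v w.
  rewrite assoc_linE.
  rewrite (@tens_coactF k H B (long_tensor U V) W); last by lin.
  rewrite (@tens_coactE k H B U (long_tensor V W)).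
  rewrite tens_coactF; last by lin.
  rewrite coact_invF; last by lin.
  apply: eq_sweedler => b u0.
  rewrite tens_coactF; last by lin.
  apply: eq_sweedler => c v0.
  rewrite coact_mapF; last by lin.
  apply: eq_sweedler => d w0; rewrite assoc_linE; congr (_ ⊗ _).
  (* The last two tensor factors agree already. Up to powers of the structure map of [B], what
     remains is Hom-associativity; its left factor, the third inverse power applied to [b], is
     rewritten as the twist of the fourth one so that the axiom applies. *)
  rewrite !hinv_mul auto_funK.
  rewrite -[auto_inv hmap (auto_inv hmap (auto_inv _ b)) in LHS](auto_invK hmap).
  by rewrite (ha_assoc (hh_algebra B)) auto_invK.
- move: x; apply: tens3_lin_eq; [by lin..|] => u v w.
  by rewrite !(tens_autoE, assoc_linE) auto_funK auto_invK.
Defined.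

Lemma long_assocE u v w :
  long_assoc ((u ⊗ v) ⊗ w) = auto_inv ld_map u ⊗ (v ⊗ ld_map w).
Proof. exact: assoc_linE. Qed.

Definition long_assoc_inv : longHom (long_tensor U (long_tensor V W))
    (long_tensor (long_tensor U V) W) :=
  @longHom_inv _ _ long_assoc assoc_inv assoc_linK assoc_invK.

Lemma long_assoc_invE u v w :
  long_assoc_inv (u ⊗ (v ⊗ w)) = (ld_map u ⊗ v) ⊗ auto_inv ld_map w.
Proof. exact: assoc_invE. Qed.

End Associator.

(** * The unit constraints *)

Section Unitors.
Variable V : Long.

(** The unit constraints apply the inverse of the structure map. The counit axiom produces one twist
    on the acting element, which this inverse removes, giving H-linearity. In the triangle it also
    cancels the structure map that the associator puts on the last factor. *)
Lemma lunit_islin : islin (fun t : k^o ⊗ V => \sw_(a, v <- t) ((a : k) *: auto_inv ld_map v)).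
Proof. by lin. Qed.

Lemma runit_islin : islin (fun t : V ⊗ k^o => \sw_(v, a <- t) ((a : k) *: auto_inv ld_map v)).
Proof. by lin. Qed.

Lemma lunitE a v : mklin lunit_islin (a ⊗ v) = a *: auto_inv ld_map v.
Proof. by rewrite /= sweedler_tens //; lin. Qed.

Lemma runitE a v : mklin runit_islin (v ⊗ a) = a *: auto_inv ld_map v.
Proof. by rewrite /= sweedler_tens //; lin. Qed.

Definition long_lunit : longHom (long_tensor (long_unit H B) V) V.
Proof.
refine (@LongHom k H B (long_tensor (long_unit H B) V) V (mklin lunit_islin) _ _ _)
  => [h|x|x].
- apply: tens_lin_eq; [by lin..|] => a v.
  rewrite lunitE tens_actE lin_sweedler; last by lin.
  under eq_sweedler => h1 h2.
    rewrite lunitE unit_actE act_inv mulrC -scalerA.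
    over.
  (* On the right [h] is written as the inverse twist of [hmap h], and [hmap h] is expanded by the
     counit axiom, to meet the sum of [counit h1] times the inverse twist of [h2] on the left. *)
  rewrite -scaler_sweedler tensZr linZ -[h in RHS](auto_funK hmap).
  rewrite -(hc_counitl (hh_coalgebra H) h) (lin_sweedler (g := auto_inv _)).
    rewrite (lin_sweedler (g := fun t => t ▹ _)); last by lin.
    congr (_ *: _); apply: eq_sweedler => h1 h2.
    by rewrite (islinZ _ _ (@islin_inv _ _ _)) tensZl linZ.
  exact: islin_inv.
- move: x; apply: tens_lin_eq; [by lin..|] => a v.
  rewrite lunitE linZ.
  rewrite (@tens_coactF k H B (long_unit H B) V); last by lin.
  rewrite unit_coactE sweedler_tens; last by lin.
  rewrite -[coact (auto_inv _ _)]sweedlerE coact_invF; last by lin.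
  rewrite scaler_sweedler; apply: eq_sweedler => c v0.
  by rewrite lunitE (ha_mul1r (hh_algebra B)) auto_funK tensZr.
- move: x; apply: tens_lin_eq; [by lin..|] => a v.
  by rewrite tens_autoE !lunitE linZ auto_funK auto_invK.
Defined.

Definition long_runit : longHom (long_tensor V (long_unit H B)) V.
Proof.
refine (@LongHom k H B (long_tensor V (long_unit H B)) V (mklin runit_islin) _ _ _)
  => [h|x|x].
- apply: tens_lin_eq; [by lin..|] => v a.
  rewrite runitE tens_actE lin_sweedler; last by lin.
  under eq_sweedler => h1 h2.
    rewrite runitE unit_actE act_inv mulrC -scalerA.
    over.
  rewrite -scaler_sweedler tensZr linZ -[h in RHS](auto_funK hmap).
  rewrite -(hc_counitr (hh_coalgebra H) h) (lin_sweedler (g := auto_inv _)).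
    rewrite (lin_sweedler (g := fun t => t ▹ _)); last by lin.
    congr (_ *: _); apply: eq_sweedler => h1 h2.
    by rewrite (islinZ _ _ (@islin_inv _ _ _)) tensZl linZ.
  exact: islin_inv.
- move: x; apply: tens_lin_eq; [by lin..|] => v a.
  rewrite runitE linZ.
  rewrite (@tens_coactF k H B V (long_unit H B)); last by lin.
  rewrite -[coact (auto_inv _ _)]sweedlerE coact_invF; last by lin.
  rewrite scaler_sweedler; apply: eq_sweedler => c v0.
  rewrite unit_coactE sweedler_tens; last by lin.
  by rewrite runitE (ha_mulr1 (hh_algebra B)) auto_funK tensZr.
- move: x; apply: tens_lin_eq; [by lin..|] => v a.
  by rewrite tens_autoE !runitE linZ auto_funK auto_invK.
Defined.

Lemma long_lunitE a v : long_lunit (a ⊗ v) = a *: auto_inv ld_map v.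
Proof. exact: lunitE. Qed.

Lemma long_runitE a v : long_runit (v ⊗ a) = a *: auto_inv ld_map v.
Proof. exact: runitE. Qed.

Lemma long_lunit_iso : @is_iso (long_category H B) _ _ long_lunit.
Proof.
apply: (@longHom_inv_iso _ _ long_lunit (fun v => (1 : k^o) ⊗ ld_map v)).
- apply: tens_lin_eq; [by lin..|] => a v.
  by rewrite long_lunitE linZ auto_invK tensZr -tensZl [_ *: 1]mulr1.
- by move=> v; rewrite long_lunitE scale1r auto_funK.
Qed.

Lemma long_runit_iso : @is_iso (long_category H B) _ _ long_runit.
Proof.
apply: (@longHom_inv_iso _ _ long_runit (fun v => ld_map v ⊗ (1 : k^o))).
- apply: tens_lin_eq; [by lin..|] => v a.
  by rewrite long_runitE linZ auto_invK tensZl -tensZr [_ *: 1]mulr1.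
- by move=> v; rewrite long_runitE scale1r auto_funK.
Qed.

End Unitors.

Lemma longHom_invmap (M N : Long) (f : longHom M N) m :
  f (auto_inv ld_map m) = auto_inv ld_map (f m).
Proof. by apply: (can_inj (auto_funK ld_map)); rewrite -lh_map !auto_invK. Qed.

End Dimodules.

(** * Naturality and coherence of the constraints *)

Section Monoidal.
Variables (k : fieldType) (H B : homHopf k).
Local Notation Long := (longDimodule H B).

Definition long_monoidal :
  @monoidal (long_category H B) (@long_tensor k H B) (long_unit H B).
Proof.
refine (@Monoidal (long_category H B) (@long_tensor k H B) (long_unit H B)
  (@long_tmap k H B) (@long_assoc k H B) (@long_assoc_inv k H B)
  (@long_lunit k H B) (@long_runit k H B) _ _ _ _ _ _ _ _ _ _ _).
- move=> X Y; apply: longHom_eq; apply: tens_lin_eq; [by lin..|] => x y.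
  by rewrite long_tmapE.
- move=> X X' X'' Y Y' Y'' f' f g' g; apply: longHom_eq.
  apply: tens_lin_eq; [by lin..|] => x y.
  transitivity (long_tmap (long_comp f' f) (long_comp g' g) (x ⊗ y)) => //.
  transitivity (long_tmap f' g' (long_tmap f g (x ⊗ y))) => //.
  by rewrite !long_tmapE.
- by move=> X Y Z; apply: longHom_eq; exact: assoc_linK.
- by move=> X Y Z; apply: longHom_eq; exact: assoc_invK.
- exact: long_lunit_iso.
- exact: long_runit_iso.
- move=> X X' Y Y' Z Z' f g h; apply: longHom_eq.
  apply: tens3_lin_eq; [by lin..|] => x y z.
  transitivity (long_assoc X' Y' Z' (long_tmap (long_tmap f g) h ((x ⊗ y) ⊗ z))) => //.
  rewrite !long_tmapE long_assocE.
  transitivity (long_tmap f (long_tmap g h) (long_assoc X Y Z ((x ⊗ y) ⊗ z))) => //.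
  by rewrite long_assocE !long_tmapE longHom_invmap lh_map.
- move=> X X' f; apply: longHom_eq; apply: tens_lin_eq; [by lin..|] => a x.
  transitivity (long_lunit X' (long_tmap (long_id (long_unit H B)) f (a ⊗ x))) => //.
  rewrite long_tmapE long_lunitE.
  transitivity (f (long_lunit X (a ⊗ x))) => //.
  by rewrite long_lunitE linZ longHom_invmap.
- move=> X X' f; apply: longHom_eq; apply: tens_lin_eq; [by lin..|] => x a.
  transitivity (long_runit X' (long_tmap f (long_id (long_unit H B)) (x ⊗ a))) => //.
  rewrite long_tmapE long_runitE.
  transitivity (f (long_runit X (x ⊗ a))) => //.
  by rewrite long_runitE linZ longHom_invmap.
- move=> X Y; apply: longHom_eq; apply: tens3_lin_eq; [by lin..|] => x a y.
  transitivity (long_tmap (long_id X) (long_lunit Y)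
    (long_assoc X (long_unit H B) Y ((x ⊗ a) ⊗ y))) => //.
  (* The inverse structure map that the associator puts on [x] is the one in the right unit
     constraint, while its structure map on [y] cancels against the left one. *)
  rewrite long_assocE !long_tmapE long_lunitE long_runitE auto_funK.
  by rewrite tensZr tensZl.
- move=> X Y Z W; apply: longHom_eq; apply: tens_lin_eq; [by lin..|] => t w.
  move: t; apply: tens3_lin_eq; [by lin..|] => x y z.
  transitivity (long_assoc X Y (long_tensor Z W) (long_assoc (long_tensor X Y) Z W
    (((x ⊗ y) ⊗ z) ⊗ w))) => //.
  rewrite long_assocE.
  transitivity (long_tmap (long_id X) (long_assoc Y Z W)
    (long_assoc X (long_tensor Y Z) W (long_tmap (long_assoc X Y Z) (long_id W)
    (((x ⊗ y) ⊗ z) ⊗ w)))) => //.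
  rewrite long_tmapE !long_assocE long_tmapE long_assocE.
  (* The associator of [X ⊗ Y], [Z], [W] inverts the structure map of [X ⊗ Y] as a whole; this
     inverse acts factorwise. *)
  have -> : auto_inv (@ld_map _ _ _ (long_tensor X Y)) (x ⊗ y) =
      auto_inv ld_map x ⊗ auto_inv ld_map y by exact: tens_auto_invE.
  by rewrite long_assocE; congr (_ ⊗ (_ ⊗ _)); exact: tens_autoE.
Defined.

End Monoidal.

(** * Inverses of [R] and of the form *)

Section Quasitriangular.
Variables (k : fieldType) (H : homHopf k) (R : H ⊗ H) (hR : quasitriangular R).

(** The axioms on [R] are equations between tensors. Here and in the next lemmas they are evaluated
    under an arbitrary multilinear [F], the form in which they can be used inside Sweedler sums. *)
Lemma qt_mapF (W : lmodType k) (F : H -> H -> W) : isbilin F ->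
  \sw_(R1, R2 <- R) F (hmap R1) (hmap R2) = sweedler R F.
Proof.
move=> bF; rewrite -[R in RHS](qt_map hR) sweedler_sweedler //.
by apply: eq_sweedler => R1 R2; rewrite sweedler_tens.
Qed.

Lemma qt_invF (W : lmodType k) (F : H -> H -> W) : isbilin F ->
  \sw_(R1, R2 <- R) F (auto_inv hmap R1) (auto_inv hmap R2) = sweedler R F.
Proof.
move=> bF; rewrite -qt_mapF; last first.
  by apply: isbilin_comp => //; exact: islin_inv.
by apply: eq_sweedler => R1 R2; rewrite !auto_funK.
Qed.

Lemma qt_comullF (W : lmodType k) (F : H -> H -> H -> W) : trilin F ->
  \sw_(R1, R2 <- R) \sw_(R11, R12 <- comul R1) F R11 R12 (hmap R2) =
  \sw_(R1, R2 <- R) \sw_(r1, r2 <- R) F (hmap R1) (hmap r1) (R2 ∗ r2).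
Proof.
move=> tF.
have := congr1 (fun t => \sw_(a, y <- t) \sw_(b, d <- y) F a b d) (qt_comull hR).
rewrite !sweedler3_sw //.
under eq_sweedler => R1 R2.
  rewrite sweedler3_sw //.
  under eq_sweedler do rewrite sweedler3 //.
  over.
move=> ->; apply: eq_sweedler => R1 R2.
rewrite sweedler3_sw //.
by apply: eq_sweedler => ? ?; rewrite sweedler3.
Qed.

Lemma qt_comulrF (W : lmodType k) (F : H -> H -> H -> W) : trilin F ->
  \sw_(R1, R2 <- R) \sw_(R21, R22 <- comul R2) F (hmap R1) R21 R22 =
  \sw_(R1, R2 <- R) \sw_(r1, r2 <- R) F (R1 ∗ r1) (hmap r2) (hmap R2).
Proof.
move=> tF.
have := congr1 (fun t => \sw_(a, y <- t) \sw_(b, d <- y) F a b d) (qt_comulr hR).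
rewrite !sweedler3_sw //.
under eq_sweedler => R1 R2.
  rewrite sweedler3_sw //.
  under eq_sweedler do rewrite sweedler3 //.
  over.
move=> ->; apply: eq_sweedler => R1 R2.
rewrite sweedler3_sw //.
by apply: eq_sweedler => ? ?; rewrite sweedler3.
Qed.

Lemma qt_commF (W : lmodType k) (F : H -> H -> W) h : isbilin F ->
  \sw_(h1, h2 <- comul h) \sw_(R1, R2 <- R) F (h2 ∗ R1) (h1 ∗ R2) =
  \sw_(h1, h2 <- comul h) \sw_(R1, R2 <- R) F (R1 ∗ h1) (R2 ∗ h2).
Proof.
move=> bF; have := congr1 (fun t => sweedler t F) (qt_comm hR h).
rewrite !(sweedler_sweedler _ _ bF).
under eq_sweedler => h1 h2.
  rewrite sweedler_sweedler //.
  under eq_sweedler do rewrite sweedler_tens //.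
  over.
move=> ->; apply: eq_sweedler => h1 h2.
rewrite sweedler_sweedler //.
by apply: eq_sweedler => ? ?; rewrite sweedler_tens.
Qed.

(** If [g] is a right convolution inverse of [f], then [(f ⊗ id) R] times [(g ⊗ id) R] is the unit.
    The formula for the coproduct of the first leg merges the two copies of [R] into one, the
    convolution becomes a counit, and the counit axiom of [R] finishes. The cases with the antipode
    on either side follow. *)
Lemma qt_convolF (f g : {linear H -> H}) (W : lmodType k) (F : H -> H -> W) :
  (forall x, f (hmap x) = hmap (f x)) -> (forall x, g (hmap x) = hmap (g x)) ->
  (forall h, \sw_(h1, h2 <- comul h) (f h1 ∗ g h2) = counit h *: hone H) ->
  isbilin F ->
  \sw_(R1, R2 <- R) \sw_(r1, r2 <- R) F (f R1 ∗ g r1) (R2 ∗ r2) =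
  F (hone H) (hone H).
Proof.
move=> fmap gmap fg [F1 F2].
(* The inverse twist cancels the [hmap] that the coproduct formula puts on both first legs; [f] and
   [g] commute with it. *)
pose G x y z := F (auto_inv hmap (f x ∗ g y)) z.
have tG : trilin G.
  split=> [y z|x]; rewrite /G; first by apply: (islin_comp (F1 z)); lin.
  by split=> [z|y]; [apply: (islin_comp (F1 z)); lin|exact: F2].
have := qt_comullF tG; rewrite /G.
under [in RHS]eq_sweedler => R1 R2.
  under eq_sweedler => r1 r2.
    rewrite fmap gmap -hmap_mul auto_funK.
    over.
  over.
move=> <-.
(* The inner sum is [counit R1] times the unit; the scalar is moved to the second leg, where the
   counit axiom of [R] can absorb it. *)
under eq_sweedler => R1 R2.
  rewrite -(lin_sweedler (g := fun t => F (auto_inv hmap t) (hmap R2))); last first.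
    by apply: (islin_comp (F1 _)); lin.
  rewrite fg (islinZ _ _ (@islin_inv _ _ _)) hinv1 (islinZ _ _ (F1 _)).
  rewrite -(islinZ _ _ (F2 _)) -linZ.
  over.
rewrite -(lin_sweedler (g := fun t => F (hone H) (hmap t))).
  by rewrite (qt_counitl hR) hmap1.
by apply: (islin_comp (F2 _)); lin.
Qed.

(* The two lemmas below: [(S ⊗ id) R] is inverse to [R]. *)
Lemma qt_antipodelF (W : lmodType k) (F : H -> H -> W) : isbilin F ->
  \sw_(R1, R2 <- R) \sw_(r1, r2 <- R) F (antipode R1 ∗ r1) (R2 ∗ r2) =
  F (hone H) (hone H).
Proof.
by apply: (qt_convolF (g := idfun)) => // x; rewrite (hh_antipode_map, hh_antipodel).
Qed.

Lemma qt_antipoderF (W : lmodType k) (F : H -> H -> W) : isbilin F ->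
  \sw_(R1, R2 <- R) \sw_(r1, r2 <- R) F (R1 ∗ antipode r1) (R2 ∗ r2) =
  F (hone H) (hone H).
Proof.
by apply: (qt_convolF (f := idfun)) => // x; rewrite (hh_antipode_map, hh_antipoder).
Qed.

End Quasitriangular.

(** * Evaluation rules and convolution inverse of the form *)

Section Coquasitriangular.
Variables (k : fieldType) (B : homHopf k) (form : {linear (B ⊗ B)%type -> k^o}).
Hypothesis hform : coquasitriangular form.

Lemma cqt_inv b c : form (auto_inv hmap b ⊗ auto_inv hmap c) = form (b ⊗ c).
Proof. by rewrite -(cqt_map hform) !auto_invK. Qed.

Lemma cqt_commF (W : lmodType k) (F : B -> W) h g : islin F ->
  \sw_(h1, h2 <- comul h) \sw_(g1, g2 <- comul g) ((form (h1 ⊗ g1) : k) *: F (g2 ∗ h2)) =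
  \sw_(h1, h2 <- comul h) \sw_(g1, g2 <- comul g) ((form (h2 ⊗ g2) : k) *: F (h1 ∗ g1)).
Proof.
move=> lF; have := congr1 F (cqt_comm hform h g).
rewrite !(lin_sweedler _ _ lF).
under eq_sweedler => h1 h2.
  rewrite (lin_sweedler _ _ lF).
  under eq_sweedler do rewrite (islinZ _ _ lF).
  over.
move=> ->; apply: eq_sweedler => h1 h2.
by rewrite (lin_sweedler _ _ lF); apply: eq_sweedler => ? ?; rewrite (islinZ _ _ lF).
Qed.

(** Multiplicativity in the second argument, with the scalars acting on a vector, for merging two
    pairings inside a Sweedler sum. *)
Lemma cqt_mulrZ (W : lmodType k) (w : W) h g l :
  \sw_(h1, h2 <- comul h) ((form (h1 ⊗ g) : k) *: ((form (h2 ⊗ l) : k) *: w)) =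
  (form (hmap h ⊗ (auto_inv hmap g ∗ auto_inv hmap l)) : k) *: w.
Proof.
rewrite (cqt_mulr hform) (lin_sweedler (g := fun a : k^o => (a : k) *: w)); last by lin.
by apply: eq_sweedler => h1 h2; rewrite !auto_invK scalerA.
Qed.

(** The counterpart in the first argument. The coproduct legs occur in reversed order here, which
    fixes the pairing of coactions in the second hexagon. *)
Lemma cqt_mullZ (W : lmodType k) (w : W) h g l :
  \sw_(l1, l2 <- comul l) ((form (h ⊗ l2) : k) *: ((form (g ⊗ l1) : k) *: w)) =
  (form ((auto_inv hmap h ∗ auto_inv hmap g) ⊗ hmap l) : k) *: w.
Proof.
rewrite (cqt_mull hform) (lin_sweedler (g := fun a : k^o => (a : k) *: w)); last by lin.
by apply: eq_sweedler => h1 h2; rewrite !auto_invK scalerA.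
Qed.

(** Multiplicativity in the second argument merges the two pairings into one with the convolution
    product of [p] and [q] at [g]. That product is [counit g] times the unit, and pairing with the
    unit gives [counit h]. *)
Lemma cqt_convol (p q : {linear B -> B}) (W : lmodType k) (w : W) h g :
  (forall x, \sw_(x1, x2 <- comul x) (p x1 ∗ q x2) = counit x *: hone B) ->
  \sw_(h1, h2 <- comul h) \sw_(g1, g2 <- comul g)
    ((form (h1 ⊗ p g1) : k) *: ((form (h2 ⊗ q g2) : k) *: w)) =
  (counit h : k) *: ((counit g : k) *: w).
Proof.
move=> pq; rewrite exchange_sweedler.
under eq_sweedler => g1 g2 do rewrite cqt_mulrZ -hinv_mul.
rewrite -(lin_sweedler (g := fun x => (form (hmap h ⊗ auto_inv hmap x) : k) *: w)).
  rewrite pq (islinZ _ _ (@islin_inv _ _ _)) hinv1 tensZr linZ.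
  by rewrite (cqt_1r hform) (hc_map_counit (hh_coalgebra B)) scalerA mulrC.
by lin.
Qed.

(* The two lemmas below: the convolution inverse of the form is
   [h ⊗ g |-> form (h ⊗ antipode g)]; on the left argument the antipode
   would have to be inverted. *)
Lemma cqt_antipoder (W : lmodType k) (w : W) h g :
  \sw_(h1, h2 <- comul h) \sw_(g1, g2 <- comul g)
    ((form (h1 ⊗ g1) : k) *: ((form (h2 ⊗ antipode g2) : k) *: w)) =
  (counit h : k) *: ((counit g : k) *: w).
Proof. by apply: (cqt_convol (p := idfun)) => x; exact: hh_antipoder. Qed.

Lemma cqt_antipodel (W : lmodType k) (w : W) h g :
  \sw_(h1, h2 <- comul h) \sw_(g1, g2 <- comul g)
    ((form (h1 ⊗ antipode g1) : k) *: ((form (h2 ⊗ g2) : k) *: w)) =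
  (counit h : k) *: ((counit g : k) *: w).
Proof. by apply: (cqt_convol (q := idfun)) => x; exact: hh_antipodel. Qed.

End Coquasitriangular.

(** * The braiding *)

Section Braiding.
Variables (k : fieldType) (H B : homHopf k) (R : H ⊗ H)
  (form : {linear (B ⊗ B)%type -> k^o}).
Hypotheses (hR : quasitriangular R) (hform : coquasitriangular form).
Local Notation Long := (longDimodule H B).

(** Each factor in the braiding formula has this shape. The Long condition contributes one twist of
    [b] and the two inverse structure maps remove two, so one inverse twist is left. *)
Lemma coact_act_invF (M : Long) (W : lmodType k) (F : B -> M -> W) h m : isbilin F ->
  sweedler (coact (h ▹ auto_inv ld_map (auto_inv ld_map m))) F =
  \sw_(b, m0 <- coact m)
    F (auto_inv hmap b) (hmap h ▹ auto_inv ld_map (auto_inv ld_map m0)).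
Proof.
move=> bF; have [F1 F2] := bF; rewrite coact_actF //.
rewrite coact_invF; last first.
  by split=> [x|x]; [apply: (islin_comp (F1 _)); lin|apply: (islin_comp (F2 _)); lin].
rewrite coact_invF; last first.
  by split=> [x|x]; [apply: (islin_comp (F1 _)); lin|apply: (islin_comp (F2 _)); lin].
by apply: eq_sweedler => b m0; rewrite auto_invK.
Qed.

(** Coassociativity in both modules at once: a second coaction on each becomes a coproduct of the
    first coefficient. The axioms of the form, stated with coproducts, then apply. *)
Lemma coact2_coassocF (M N : Long) (W : lmodType k)
    (G : B -> B -> M -> B -> B -> N -> W) m n :
  (forall c c' n', trilin (fun b b' m' => G b b' m' c c' n')) ->
  (forall b b' m', trilin (G b b' m')) ->
  \sw_(b, m0 <- coact m) \sw_(b', m00 <- coact m0)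
    \sw_(c, n0 <- coact n) \sw_(c', n00 <- coact n0) G b b' m00 c c' n00 =
  \sw_(b, m0 <- coact m) \sw_(c, n0 <- coact n)
    \sw_(b1, b2 <- comul b) \sw_(c1, c2 <- comul c)
      G (auto_inv hmap b1) b2 (ld_map m0) (auto_inv hmap c1) c2 (ld_map n0).
Proof.
move=> tl tr.
under eq_sweedler => b m0.
  under eq_sweedler => b' m00.
    rewrite coact_coassoc_invF //.
    over.
  over.
rewrite (coact_coassoc_invF (F := fun b b' m' => \sw_(c, n0 <- coact n)
  \sw_(c1, c2 <- comul c) G b b' m' (auto_inv hmap c1) c2 (ld_map n0))).
  by apply: eq_sweedler => b m0; rewrite exchange_sweedler.
split=> [b' m'|b].
  apply: islin_sweedlerf => c n0; apply: islin_sweedlerf => c1 c2.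
  exact: (tl _ _ _).1.
by split=> [m'|b']; apply: islin_sweedlerf => c n0;
  apply: islin_sweedlerf => c1 c2; [apply: ((tl _ _ _).2 _).1|apply: ((tl _ _ _).2 _).2].
Qed.

(** * The braiding morphism and its inverse map *)

Section Components.
Variables M N : Long.

Lemma braid_islin : islin (fun t : M ⊗ N =>
  \sw_(m, n <- t) \sw_(b, m0 <- coact m) \sw_(c, n0 <- coact n) \sw_(R1, R2 <- R)
    ((form (b ⊗ c) : k) *:
      ((R2 ▹ auto_inv ld_map (auto_inv ld_map n0)) ⊗
       (R1 ▹ auto_inv ld_map (auto_inv ld_map m0))))).
Proof. by lin. Qed.

Definition braid_lin : {linear (M ⊗ N)%type -> (N ⊗ M)%type} := mklin braid_islin.

Lemma braid_linE m n : braid_lin (m ⊗ n) =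
  \sw_(b, m0 <- coact m) \sw_(c, n0 <- coact n) \sw_(R1, R2 <- R)
    ((form (b ⊗ c) : k) *:
      ((R2 ▹ auto_inv ld_map (auto_inv ld_map n0)) ⊗
       (R1 ▹ auto_inv ld_map (auto_inv ld_map m0)))).
Proof. by rewrite /braid_lin /= sweedler_tens //; lin. Qed.

Lemma braid_linF (W : lmodType k) (F : N -> M -> W) m n : isbilin F ->
  sweedler (braid_lin (m ⊗ n)) F =
  \sw_(b, m0 <- coact m) \sw_(c, n0 <- coact n) \sw_(R1, R2 <- R)
    ((form (b ⊗ c) : k) *:
      F (R2 ▹ auto_inv ld_map (auto_inv ld_map n0))
        (R1 ▹ auto_inv ld_map (auto_inv ld_map m0))).
Proof.
move=> bF; rewrite braid_linE sweedler_sweedler //.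
apply: eq_sweedler => b m0; rewrite sweedler_sweedler //.
apply: eq_sweedler => c n0; rewrite sweedler_sweedler //.
apply: eq_sweedler => R1 R2.
by rewrite (islinZ _ _ (sweedler_linear bF)) sweedler_tens.
Qed.

Lemma braid_act h t : braid_lin (tens_act M N (h ⊗ t)) = tens_act N M (h ⊗ braid_lin t).
Proof.
move: t; apply: tens_lin_eq; [by lin..|] => m n.
rewrite tens_actE lin_sweedler; last by lin.
(* Nested actions are collapsed on both sides, so that the two normal forms differ only by the order
   of the products of legs of [R] and of [comul h], and [qt_commF] relates them. *)
transitivity (\sw_(b, m0 <- coact m) \sw_(c, n0 <- coact n)
  ((form (b ⊗ c) : k) *: \sw_(h1, h2 <- comul h) \sw_(R1, R2 <- R)
     ((auto_inv hmap (R2 ∗ h2) ▹ auto_inv ld_map n0) ⊗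
      (auto_inv hmap (R1 ∗ h1) ▹ auto_inv ld_map m0)))).
  under eq_sweedler => h1 h2.
    rewrite braid_linE coact_actF; last by lin.
    over.
  rewrite exchange_sweedler; apply: eq_sweedler => b m0.
  under eq_sweedler => h1 h2.
    rewrite coact_actF; last by lin.
    over.
  rewrite exchange_sweedler; apply: eq_sweedler => c n0.
  rewrite scaler_sweedler; apply: eq_sweedler => h1 h2.
  rewrite scaler_sweedler; apply: eq_sweedler => R1 R2.
  by rewrite (cqt_map hform) !act_inv !act_act !auto_invK !auto_funK !hinv_mul.
transitivity (\sw_(b, m0 <- coact m) \sw_(c, n0 <- coact n)
  ((form (b ⊗ c) : k) *: \sw_(h1, h2 <- comul h) \sw_(R1, R2 <- R)
     ((auto_inv hmap (h1 ∗ R2) ▹ auto_inv ld_map n0) ⊗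
      (auto_inv hmap (h2 ∗ R1) ▹ auto_inv ld_map m0)))).
  apply: eq_sweedler => b m0; apply: eq_sweedler => c n0; congr (_ *: _).
  symmetry; apply: (qt_commF hR (F := fun x y => (auto_inv hmap y ▹ _) ⊗ (auto_inv hmap x ▹ _))).
  by lin.
rewrite braid_linE (lin_sweedler (g := fun t => tens_act N M (h ⊗ t))); last by lin.
apply: eq_sweedler => b m0.
rewrite (lin_sweedler (g := fun t => tens_act N M (h ⊗ t))); last by lin.
apply: eq_sweedler => c n0.
rewrite (lin_sweedler (g := fun t => tens_act N M (h ⊗ t))); last by lin.
rewrite exchange_sweedler scaler_sweedler.
under [RHS]eq_sweedler => R1 R2.
  rewrite tensZr linZ tens_actE.
  under eq_sweedler do rewrite !act_act !auto_invK.
  over.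
(* Invariance of [R] supplies the inverse twist on its legs that [auto_inv hmap (h1 ∗ R2)]
   requires. *)
rewrite -(qt_invF hR (F := fun x y => _ *: \sw_(h1, h2 <- comul h)
  (((auto_inv hmap h1 ∗ y) ▹ _) ⊗ ((auto_inv hmap h2 ∗ x) ▹ _)))); last by lin.
apply: eq_sweedler => R1 R2; congr (_ *: _); apply: eq_sweedler => h1 h2.
by rewrite !hinv_mul.
Qed.

Lemma braid_coact t :
  coact (l := long_tensor N M) (braid_lin t) =
  \sw_(b, t0 <- coact (l := long_tensor M N) t) (b ⊗ braid_lin t0).
Proof.
move: t; apply: tens_lin_eq; [by lin..|] => m n.
(* [F] gathers all that the two sides share, so that only the argument [x] and the pairing have to
   be compared. Of its three inverse twists, two come from the tensor coaction and one from
   [coact_act_invF]. *)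
pose F x m' n' : B ⊗ (N ⊗ M) := \sw_(R1, R2 <- R)
  (auto_inv hmap (auto_inv hmap (auto_inv hmap x)) ⊗
   ((R2 ▹ auto_inv ld_map n') ⊗ (R1 ▹ auto_inv ld_map m'))).
transitivity (\sw_(b, m0 <- coact m) \sw_(c, n0 <- coact n)
  \sw_(b1, b2 <- comul b) \sw_(c1, c2 <- comul c)
    ((form (b1 ⊗ c1) : k) *: F (c2 ∗ b2) m0 n0)).
  transitivity (\sw_(b, m0 <- coact m) \sw_(b', m00 <- coact m0)
    \sw_(c, n0 <- coact n) \sw_(c', n00 <- coact n0)
    ((form (b ⊗ c) : k) *: F (c' ∗ b') (auto_inv ld_map m00) (auto_inv ld_map n00))).
    rewrite braid_linE lin_sweedler; last by lin.
    apply: eq_sweedler => b m0; rewrite lin_sweedler; last by lin.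
    rewrite exchange_sweedler; apply: eq_sweedler => c n0.
    rewrite lin_sweedler; last by lin.
    transitivity (\sw_(R1, R2 <- R) ((form (b ⊗ c) : k) *:
      \sw_(c', n00 <- coact n0) \sw_(b', m00 <- coact m0)
      (auto_inv hmap (auto_inv hmap (auto_inv hmap c' ∗ auto_inv hmap b')) ⊗
       ((R2 ▹ auto_inv ld_map (auto_inv ld_map n00)) ⊗
        (R1 ▹ auto_inv ld_map (auto_inv ld_map m00)))))).
      rewrite -(qt_mapF hR (F := fun R1 R2 => _ *: \sw_(c', n00 <- coact n0)
        \sw_(b', m00 <- coact m0) (_ ⊗ ((R2 ▹ _) ⊗ (R1 ▹ _))))); last by lin.
      apply: eq_sweedler => R1 R2; rewrite linZ; congr (_ *: _).
      rewrite (@tens_coactE k H B N M) coact_act_invF; last by lin.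
      apply: eq_sweedler => c' n00; rewrite coact_act_invF //; last by lin.
    rewrite [RHS]exchange_sweedler -[LHS]scaler_sweedler.
    rewrite [X in _ *: X]exchange_sweedler [LHS]scaler_sweedler.
    apply: eq_sweedler => c' n00; rewrite [X in _ *: X]exchange_sweedler [LHS]scaler_sweedler.
    apply: eq_sweedler => b' m00; rewrite /F; congr (_ *: _).
    by apply: eq_sweedler => R1 R2; rewrite !hinv_mul.
  rewrite (coact2_coassocF (G := fun b b' m' c c' n' =>
    (form (b ⊗ c) : k) *: F (c' ∗ b') (auto_inv ld_map m') (auto_inv ld_map n'))).
  - apply: eq_sweedler => b m0; apply: eq_sweedler => c n0.
    apply: eq_sweedler => b1 b2; apply: eq_sweedler => c1 c2.
    by rewrite (cqt_inv hform) !auto_funK.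
  - by rewrite /F; split=> [x y|x]; lin.
  - by rewrite /F; split=> [x y|x]; lin.
transitivity (\sw_(b, m0 <- coact m) \sw_(c, n0 <- coact n)
  \sw_(b1, b2 <- comul b) \sw_(c1, c2 <- comul c)
    ((form (b2 ⊗ c2) : k) *: F (b1 ∗ c1) m0 n0)).
  apply: eq_sweedler => b m0; apply: eq_sweedler => c n0.
  by apply: (cqt_commF hform (F := fun x => F x m0 n0)); rewrite /F; lin.
rewrite (@tens_coactF k H B M N); last by lin.
(* The coaction of the source comes before the braiding and so carries only two inverse twists;
   [hmap] compensates for the third one in [F]. *)
pose G b b' m' c c' n' : B ⊗ (N ⊗ M) := (form (b' ⊗ c') : k) *: F (hmap (b ∗ c))
  (auto_inv ld_map m') (auto_inv ld_map n').
transitivity (\sw_(b, m0 <- coact m) \sw_(b', m00 <- coact m0)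
  \sw_(c, n0 <- coact n) \sw_(c', n00 <- coact n0) G b b' m00 c c' n00).
  rewrite (coact2_coassocF (G := G)).
  - apply: eq_sweedler => b m0; apply: eq_sweedler => c n0.
    apply: eq_sweedler => b1 b2; apply: eq_sweedler => c1 c2.
    by rewrite /G hmap_mul !auto_invK !auto_funK.
  - by rewrite /G /F; split=> [x y|x]; lin.
  - by rewrite /G /F; split=> [x y|x]; lin.
apply: eq_sweedler => b m0; rewrite exchange_sweedler.
apply: eq_sweedler => c n0; rewrite braid_linE.
rewrite (lin_sweedler (g := fun t => _ ⊗ t)); last by lin.
apply: eq_sweedler => b' m00.
rewrite (lin_sweedler (g := fun t => _ ⊗ t)); last by lin.
apply: eq_sweedler => c' n00.
rewrite (lin_sweedler (g := fun t => _ ⊗ t)); last by lin.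
rewrite /G /F scaler_sweedler; apply: eq_sweedler => R1 R2.
by rewrite auto_funK tensZr.
Qed.

Lemma braid_map t : braid_lin (ld_map (l := long_tensor M N) t) =
  ld_map (l := long_tensor N M) (braid_lin t).
Proof.
move: t; apply: tens_lin_eq; [by lin..|] => m n.
rewrite tens_autoE braid_linE coact_mapF; last by lin.
rewrite braid_linE lin_sweedler; last by lin.
apply: eq_sweedler => b m0; rewrite coact_mapF; last by lin.
rewrite lin_sweedler; last by lin.
apply: eq_sweedler => c n0; rewrite lin_sweedler; last by lin.
rewrite -(qt_mapF hR (F := fun R1 R2 => _ *: ((R2 ▹ _) ⊗ (R1 ▹ _)))); last by lin.
apply: eq_sweedler => R1 R2; rewrite linZ (cqt_map hform) tens_autoE !act_map.
by rewrite !auto_funK !auto_invK.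
Qed.

Definition long_braid : longHom (long_tensor M N) (long_tensor N M) :=
  @LongHom k H B (long_tensor M N) (long_tensor N M) braid_lin
    braid_act braid_coact braid_map.

Definition braid_inv (t : N ⊗ M) : M ⊗ N :=
  \sw_(n, m <- t) \sw_(b, m0 <- coact m) \sw_(c, n0 <- coact n) \sw_(R1, R2 <- R)
    ((form (b ⊗ antipode c) : k) *:
      ((antipode R1 ▹ auto_inv ld_map (auto_inv ld_map m0)) ⊗
       (R2 ▹ auto_inv ld_map (auto_inv ld_map n0)))).

Lemma braid_inv_islin : islin braid_inv.
Proof. by rewrite /braid_inv; lin. Qed.

Lemma braid_invE n m : braid_inv (n ⊗ m) =
  \sw_(b, m0 <- coact m) \sw_(c, n0 <- coact n) \sw_(R1, R2 <- R)
    ((form (b ⊗ antipode c) : k) *: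
      ((antipode R1 ▹ auto_inv ld_map (auto_inv ld_map m0)) ⊗
       (R2 ▹ auto_inv ld_map (auto_inv ld_map n0)))).
Proof. by rewrite /braid_inv sweedler_tens //; lin. Qed.

Lemma braid_linK : cancel braid_lin braid_inv.
Proof.
apply: tens_lin_eq; [|by lin|] => [|m n].
  by apply: islin_comp; [exact: braid_inv_islin|exact: islin_linear].
(* The two copies of [R] are cancelled first, leaving only the two pairings. Coassociativity then
   turns the double coactions into coproducts, the pairings convolve to counits, and these restore
   [m] and [n]. *)
transitivity (\sw_(b, m0 <- coact m) \sw_(b', m00 <- coact m0)
  \sw_(c, n0 <- coact n) \sw_(c', n00 <- coact n0)
    ((form (b ⊗ c) : k) *: ((form (b' ⊗ antipode c') : k) *:
      (auto_inv ld_map (auto_inv ld_map m00) ⊗ auto_inv ld_map (auto_inv ld_map n00))))).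
  rewrite /braid_inv braid_linF; last by lin.
  apply: eq_sweedler => b m0; rewrite [RHS]exchange_sweedler; apply: eq_sweedler => c n0.
  under eq_sweedler => R1 R2.
    rewrite coact_act_invF; last by lin.
    under eq_sweedler => b' m00.
      rewrite coact_act_invF; last by lin.
      over.
    over.
  rewrite -scaler_sweedler exchange_sweedler scaler_sweedler.
  apply: eq_sweedler => b' m00; rewrite exchange_sweedler scaler_sweedler.
  apply: eq_sweedler => c' n00; congr (_ *: _).
  rewrite antipode_inv (cqt_inv hform) exchange_sweedler.
  under eq_sweedler => r1 r2.
    under eq_sweedler do rewrite !act_inv !act_act !auto_funK -!hinv_mul !auto_invK.
    over.
  under eq_sweedler do rewrite -scaler_sweedler.
  rewrite -scaler_sweedler.
  rewrite (qt_antipodelF hR (F := fun x y => (auto_inv hmap x ▹ _) ⊗ (auto_inv hmap y ▹ _))).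
    by rewrite hinv1 !act1 !auto_invK.
  by lin.
rewrite (coact2_coassocF (G := fun b b' m' c c' n' =>
  (form (b ⊗ c) : k) *: ((form (b' ⊗ antipode c') : k) *:
    (auto_inv ld_map (auto_inv ld_map m') ⊗ auto_inv ld_map (auto_inv ld_map n'))))).
- rewrite -[m in RHS]coact_counit (lin_sweedler (g := fun t => t ⊗ n)); last by lin.
  apply: eq_sweedler => b m0; rewrite tensZl.
  rewrite -[n in RHS]coact_counit (lin_sweedler (g := fun t => _ *: (_ ⊗ t))); last by lin.
  apply: eq_sweedler => c n0; rewrite tensZr -(cqt_antipoder hform).
  apply: eq_sweedler => b1 b2; apply: eq_sweedler => c1 c2.
  by rewrite (cqt_inv hform) !auto_funK.
- by split=> [x y|x]; lin.
- by split=> [x y|x]; lin.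
Qed.

Lemma braid_invK : cancel braid_inv braid_lin.
Proof.
apply: tens_lin_eq; [|by lin|] => [|n m].
  by apply: islin_comp; [exact: islin_linear|exact: braid_inv_islin].
(* The same reduction, with the inverses of [R] and of the form now on the opposite side. *)
transitivity (\sw_(b, m0 <- coact m) \sw_(b', m00 <- coact m0)
  \sw_(c, n0 <- coact n) \sw_(c', n00 <- coact n0)
    ((form (b ⊗ antipode c) : k) *: ((form (b' ⊗ c') : k) *:
      (auto_inv ld_map (auto_inv ld_map n00) ⊗ auto_inv ld_map (auto_inv ld_map m00))))).
  rewrite braid_invE lin_sweedler; last by lin.
  apply: eq_sweedler => b m0; rewrite [RHS]exchange_sweedler.
  rewrite lin_sweedler; last by lin.
  apply: eq_sweedler => c n0; rewrite lin_sweedler; last by lin.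
  under eq_sweedler => R1 R2.
    rewrite linZ braid_linE coact_act_invF; last by lin.
    under eq_sweedler => b' m00.
      rewrite coact_act_invF; last by lin.
      over.
    over.
  rewrite -scaler_sweedler exchange_sweedler scaler_sweedler.
  apply: eq_sweedler => b' m00; rewrite exchange_sweedler scaler_sweedler.
  apply: eq_sweedler => c' n00; congr (_ *: _).
  rewrite (cqt_inv hform) exchange_sweedler.
  under eq_sweedler => r1 r2.
    under eq_sweedler do rewrite !act_inv !act_act !auto_funK -!hinv_mul !auto_invK.
    over.
  under eq_sweedler do rewrite -scaler_sweedler.
  rewrite -scaler_sweedler.
  rewrite (qt_antipoderF hR (F := fun x y => (auto_inv hmap y ▹ _) ⊗ (auto_inv hmap x ▹ _))).
    by rewrite hinv1 !act1 !auto_invK.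
  by lin.
rewrite (coact2_coassocF (G := fun b b' m' c c' n' =>
  (form (b ⊗ antipode c) : k) *: ((form (b' ⊗ c') : k) *:
    (auto_inv ld_map (auto_inv ld_map n') ⊗ auto_inv ld_map (auto_inv ld_map m'))))).
- rewrite -[m in RHS]coact_counit (lin_sweedler (g := fun t => n ⊗ t)); last by lin.
  apply: eq_sweedler => b m0; rewrite tensZr.
  rewrite -[n in RHS]coact_counit (lin_sweedler (g := fun t => _ *: (t ⊗ _))); last by lin.
  apply: eq_sweedler => c n0; rewrite tensZl -(cqt_antipodel hform).
  apply: eq_sweedler => b1 b2; apply: eq_sweedler => c1 c2.
  by rewrite antipode_inv (cqt_inv hform) !auto_funK.
- by split=> [x y|x]; lin.
- by split=> [x y|x]; lin.
Qed.

End Components.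

(** * Naturality and hexagons *)

Lemma long_braidE (M N : Long) m n : long_braid M N (m ⊗ n) =
  \sw_(b, m0 <- coact m) \sw_(c, n0 <- coact n) \sw_(R1, R2 <- R)
    ((form (b ⊗ c) : k) *:
      ((R2 ▹ auto_inv ld_map (auto_inv ld_map n0)) ⊗
       (R1 ▹ auto_inv ld_map (auto_inv ld_map m0)))).
Proof. exact: braid_linE. Qed.

Lemma long_braid_nat (M M' N N' : Long) (f : longHom M M') (g : longHom N N') t :
  long_braid M' N' (long_tmap f g t) = long_tmap g f (long_braid M N t).
Proof.
move: t; apply: tens_lin_eq; [by lin..|] => m n.
rewrite long_tmapE !long_braidE lh_coact sweedler_sweedler; last by lin.
rewrite lin_sweedler; last by lin.
apply: eq_sweedler => b m0; rewrite sweedler_tens; last by lin.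
rewrite lh_coact sweedler_sweedler; last by lin.
rewrite lin_sweedler; last by lin.
apply: eq_sweedler => c n0; rewrite sweedler_tens; last by lin.
rewrite lin_sweedler; last by lin.
by apply: eq_sweedler => R1 R2; rewrite linZ long_tmapE !lh_act !longHom_invmap.
Qed.

Lemma long_tensor_inv (M N : Long) m n :
  auto_inv (@ld_map _ _ _ (long_tensor M N)) (m ⊗ n) =
  auto_inv ld_map m ⊗ auto_inv ld_map n.
Proof. exact: tens_auto_invE. Qed.

Lemma long_braid_hexagonl (U V W : Long) t :
  long_assoc V W U (long_braid U (long_tensor V W) (long_assoc U V W t)) =
  long_tmap (long_id V) (long_braid U W)
    (long_assoc V U W (long_tmap (long_braid U V) (long_id W) t)).
Proof.
move: t; apply: tens3_lin_eq; [by lin..|] => u v w.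
(* [K] is the contribution of [R], written as in the coproduct formula for the second leg: [r2] acts
   on [v], [R2] on [w], and the product [R1 ∗ r1] on [u]. *)
pose K v' w' u' : V ⊗ (W ⊗ U) := \sw_(R1, R2 <- R) \sw_(r1, r2 <- R)
  ((r2 ▹ auto_inv ld_map (auto_inv ld_map (auto_inv ld_map v'))) ⊗
   ((hmap R2 ▹ auto_inv ld_map w') ⊗
    ((R1 ∗ r1) ▹ auto_inv ld_map (auto_inv ld_map (auto_inv ld_map u'))))).
(* The meeting point coacts twice on [u], pairing the first coefficient with [v] and the second with
   [w]. The braiding with [V ⊗ W] reaches it by coassociativity and multiplicativity in the second
   argument; the two successive braidings produce it directly. *)
transitivity (\sw_(b, u0 <- coact u) \sw_(b', u00 <- coact u0)
  \sw_(c, v0 <- coact v) \sw_(d, w0 <- coact w)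
  ((form (hmap b ⊗ hmap c) : k) *: ((form (b' ⊗ hmap (hmap d)) : k) *: K v0 w0 u00))).
- rewrite (coact_coassocF (F := fun b b' u' => \sw_(c, v0 <- coact v)
    \sw_(d, w0 <- coact w) ((form (b ⊗ hmap c) : k) *:
      ((form (b' ⊗ hmap (hmap d)) : k) *: K v0 w0 u')))); last first.
    by rewrite /K; split=> [x y|x]; lin.
  rewrite long_assocE long_braidE coact_invF; last by lin.
  rewrite lin_sweedler; last by lin.
  apply: eq_sweedler => b u0; rewrite [RHS]exchange_sweedler.
  rewrite (@tens_coactF k H B V W); last by lin.
  rewrite lin_sweedler; last by lin.
  apply: eq_sweedler => c v0; rewrite [RHS]exchange_sweedler coact_mapF; last by lin.
  rewrite lin_sweedler; last by lin.
  apply: eq_sweedler => d w0; rewrite (cqt_mulrZ hform).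
  have -> : form (auto_inv hmap b ⊗ auto_inv hmap (auto_inv hmap (c ∗ hmap d))) =
      form (hmap b ⊗ (c ∗ hmap d)).
    by rewrite -[LHS](cqt_map hform) !auto_invK -[LHS](cqt_map hform) auto_invK.
  rewrite !auto_funK -scaler_sweedler linZ; congr (_ *: _).
  rewrite lin_sweedler; last by lin.
  rewrite !long_tensor_inv auto_funK.
  under eq_sweedler => R1 R2.
    rewrite tens_actE (lin_sweedler (g := fun t => t ⊗ _)); last by lin.
    rewrite lin_sweedler; last by lin.
    under eq_sweedler do rewrite long_assocE act_inv act_map auto_invK.
    over.
  rewrite (qt_comulrF hR (F := fun a x y => (auto_inv hmap x ▹ _) ⊗ ((y ▹ _) ⊗ (a ▹ _)))).
    rewrite /K; apply: eq_sweedler => R1 R2; apply: eq_sweedler => r1 r2.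
    by rewrite !auto_funK.
  by split=> [x y|x]; lin.
- rewrite long_tmapE long_braidE (lin_sweedler (g := fun t => t ⊗ _)); last by lin.
  rewrite lin_sweedler; last by lin.
  rewrite lin_sweedler; last by lin.
  apply: eq_sweedler => b u0; rewrite [LHS]exchange_sweedler.
  rewrite (lin_sweedler (g := fun t => t ⊗ _)); last by lin.
  rewrite lin_sweedler; last by lin.
  rewrite lin_sweedler; last by lin.
  apply: eq_sweedler => c v0.
  rewrite (lin_sweedler (g := fun t => t ⊗ _)); last by lin.
  rewrite lin_sweedler; last by lin.
  rewrite lin_sweedler; last by lin.
  transitivity ((form (b ⊗ c) : k) *: \sw_(b', u00 <- coact u0) \sw_(d, w0 <- coact w)
    ((form (b' ⊗ hmap (hmap d)) : k) *: K v0 w0 u00)).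
    rewrite (cqt_map hform) scaler_sweedler; apply: eq_sweedler => b' u00.
    by rewrite scaler_sweedler.
  under [RHS]eq_sweedler => r1 r2.
    rewrite tensZl !linZ long_assocE long_tmapE long_braidE.
    rewrite coact_act_invF; last by lin.
    rewrite (lin_sweedler (g := fun t => _ ⊗ t)); last by lin.
    under eq_sweedler => b' u00.
      rewrite coact_mapF; last by lin.
      rewrite (lin_sweedler (g := fun t => _ ⊗ t)); last by lin.
      under eq_sweedler => d w0.
        rewrite -scaler_sweedler tensZr (lin_sweedler (g := fun t => _ ⊗ t)); last by lin.
        over.
      over.
    over.
  rewrite -[RHS]scaler_sweedler; congr (_ *: _).
  rewrite [RHS]exchange_sweedler; apply: eq_sweedler => b' u00.
  rewrite [RHS]exchange_sweedler; apply: eq_sweedler => d w0.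
  rewrite -[RHS]scaler_sweedler; congr (_ *: _).
    by rewrite -[RHS](cqt_map hform) auto_invK.
  rewrite [RHS]exchange_sweedler /K.
  (* Both copies of [R] are untwisted by invariance, to match the powers left by collapsing the
     nested actions. *)
  rewrite -(qt_invF hR (F := fun R1 R2 => \sw_(r1, r2 <- R)
    ((r2 ▹ _) ⊗ ((hmap R2 ▹ _) ⊗ ((R1 ∗ r1) ▹ _))))); last by lin.
  apply: eq_sweedler => R1 R2.
  rewrite -(qt_invF hR (F := fun r1 r2 =>
    ((r2 ▹ _) ⊗ ((_ ▹ _) ⊗ ((_ ∗ r1) ▹ _))))); last by lin.
  apply: eq_sweedler => r1 r2.
  by rewrite !act_inv !act_act !auto_invK !auto_funK.
Qed.

Lemma long_braid_hexagonr (U V W : Long) t :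
  long_assoc_inv W U V (long_braid (long_tensor U V) W (long_assoc_inv U V W t)) =
  long_tmap (long_braid U W) (long_id V)
    (long_assoc_inv U W V (long_tmap (long_id U) (long_braid V W) t)).
Proof.
move: t; apply: tens3r_lin_eq; [by lin..|] => u v w.
(* The mirror normal form, from the coproduct formula for the first leg: the product [R2 ∗ r2] acts
   on [w]. *)
pose K u' v' w' : (W ⊗ U) ⊗ V := \sw_(R1, R2 <- R) \sw_(r1, r2 <- R)
  ((((R2 ∗ r2) ▹ auto_inv ld_map (auto_inv ld_map (auto_inv ld_map w'))) ⊗
    (hmap R1 ▹ auto_inv ld_map u')) ⊗
   (r1 ▹ auto_inv ld_map (auto_inv ld_map (auto_inv ld_map v')))).
(* Now [w] is coacted on twice. The first coefficient [d] pairs with [v] and the second one [d']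
   with [u], in agreement with the reversed legs in [cqt_mullZ]. *)
pose F d d' w' := \sw_(b, u0 <- coact u) \sw_(c, v0 <- coact v)
  ((form (hmap (hmap b) ⊗ d') : k) *: ((form (hmap c ⊗ d) : k) *: K u0 v0 w')).
transitivity (\sw_(d, w0 <- coact w) \sw_(d', w00 <- coact w0) F (hmap d) d' w00).
- rewrite coact_coassocF; last by rewrite /F /K; split=> [x y|x]; lin.
  transitivity (\sw_(d, w0 <- coact w) \sw_(b, u0 <- coact u) \sw_(c, v0 <- coact v)
    ((form ((hmap b ∗ c) ⊗ hmap d) : k) *: K u0 v0 (ld_map w0))); last first.
    apply: eq_sweedler => d w0; rewrite [RHS]exchange_sweedler.
    apply: eq_sweedler => b u0; rewrite [RHS]exchange_sweedler.
    by apply: eq_sweedler => c v0; rewrite (cqt_mullZ hform) !auto_funK.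
  rewrite long_assoc_invE long_braidE [RHS]exchange_sweedler.
  rewrite (@tens_coactF k H B U V); last by lin.
  rewrite coact_mapF; last by lin.
  rewrite lin_sweedler; last by lin.
  apply: eq_sweedler => b u0; rewrite [RHS]exchange_sweedler.
  rewrite lin_sweedler; last by lin.
  apply: eq_sweedler => c v0; rewrite coact_invF; last by lin.
  rewrite lin_sweedler; last by lin.
  apply: eq_sweedler => d w0.
  have -> : form (auto_inv hmap (auto_inv hmap (hmap b ∗ c)) ⊗ auto_inv hmap d) =
      form ((hmap b ∗ c) ⊗ hmap d).
    by rewrite -[LHS](cqt_map hform) !auto_invK -[LHS](cqt_map hform) auto_invK.
  rewrite -scaler_sweedler linZ; congr (_ *: _).
  rewrite lin_sweedler; last by lin.
  rewrite !long_tensor_inv auto_funK.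
  under eq_sweedler => R1 R2.
    rewrite tens_actE (lin_sweedler (g := fun t => _ ⊗ t)); last by lin.
    rewrite lin_sweedler; last by lin.
    under eq_sweedler do rewrite long_assoc_invE act_inv act_map auto_invK.
    over.
  rewrite (qt_comullF hR (F := fun x y a => ((a ▹ _) ⊗ (x ▹ _)) ⊗ (auto_inv hmap y ▹ _))).
    rewrite /K; apply: eq_sweedler => R1 R2; apply: eq_sweedler => r1 r2.
    by rewrite !auto_funK.
  by split=> [x y|x]; lin.
- transitivity (\sw_(c, v0 <- coact v) \sw_(d, w0 <- coact w) ((form (c ⊗ d) : k) *:
    \sw_(b, u0 <- coact u) \sw_(d', w00 <- coact w0)
    ((form (hmap (hmap b) ⊗ d') : k) *: K u0 v0 w00))).
    rewrite /F [RHS]exchange_sweedler; apply: eq_sweedler => d w0.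
    under [RHS]eq_sweedler do rewrite scaler_sweedler.
    rewrite [LHS]exchange_sweedler [RHS]exchange_sweedler; apply: eq_sweedler => b u0.
    rewrite [LHS]exchange_sweedler; apply: eq_sweedler => c v0.
    rewrite scaler_sweedler; apply: eq_sweedler => d' w00.
    by rewrite (cqt_map hform) !scalerA mulrC.
  rewrite long_tmapE long_braidE (lin_sweedler (g := fun t => _ ⊗ t)); last by lin.
  rewrite lin_sweedler; last by lin.
  rewrite lin_sweedler; last by lin.
  apply: eq_sweedler => c v0.
  rewrite (lin_sweedler (g := fun t => _ ⊗ t)); last by lin.
  rewrite lin_sweedler; last by lin.
  rewrite lin_sweedler; last by lin.
  apply: eq_sweedler => d w0.
  rewrite (lin_sweedler (g := fun t => _ ⊗ t)); last by lin.
  rewrite lin_sweedler; last by lin.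
  rewrite lin_sweedler; last by lin.
  under [RHS]eq_sweedler => r1 r2.
    rewrite tensZr !linZ long_assoc_invE long_tmapE long_braidE.
    rewrite coact_mapF; last by lin.
    rewrite (lin_sweedler (g := fun t => t ⊗ _)); last by lin.
    under eq_sweedler => b u0.
      rewrite coact_act_invF; last by lin.
      rewrite (lin_sweedler (g := fun t => t ⊗ _)); last by lin.
      under eq_sweedler => d' w00.
        rewrite -scaler_sweedler tensZl (lin_sweedler (g := fun t => t ⊗ _)); last by lin.
        over.
      over.
    over.
  rewrite -[RHS]scaler_sweedler; congr (_ *: _).
  rewrite [RHS]exchange_sweedler; apply: eq_sweedler => b u0.
  rewrite [RHS]exchange_sweedler; apply: eq_sweedler => d' w00.
  rewrite -[RHS]scaler_sweedler; congr (_ *: _).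
    by rewrite -[RHS](cqt_map hform) auto_invK.
  rewrite [RHS]exchange_sweedler /K.
  rewrite -(qt_invF hR (F := fun R1 R2 => \sw_(r1, r2 <- R)
    ((((R2 ∗ r2) ▹ _) ⊗ (hmap R1 ▹ _)) ⊗ (r1 ▹ _)))); last by lin.
  apply: eq_sweedler => R1 R2.
  rewrite -(qt_invF hR (F := fun r1 r2 =>
    (((_ ∗ r2) ▹ _) ⊗ _) ⊗ (r1 ▹ _))); last by lin.
  apply: eq_sweedler => r1 r2.
  by rewrite !act_inv !act_act !auto_invK !auto_funK.
Qed.

(** * Assembly of the braided monoidal category *)

Lemma long_braid_is_braiding : is_braiding (long_monoidal H B) long_braid.
Proof.
split=> [X Y|X X' Y Y' f g|X Y Z|X Y Z].
- exact: (@longHom_inv_iso _ _ _ _ _ (long_braid X Y) _ (@braid_linK X Y) (@braid_invK X Y)).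
- by apply: longHom_eq => t; exact: long_braid_nat.
- by apply: longHom_eq => t; exact: long_braid_hexagonl.
- by apply: longHom_eq => t; exact: long_braid_hexagonr.
Qed.

End Braiding.

Theorem theorem3p1 (k : fieldType)
    (H : homHopf k) (R : H ⊗ H) (hR : quasitriangular R)
    (B : homHopf k) (form : {linear (B ⊗ B)%type -> k^o})
    (hform : coquasitriangular form) :
  exists (S : @monoidal (long_category H B) (@long_tensor k H B) (long_unit H B))
    (C : forall M N : longDimodule H B, longHom (long_tensor M N) (long_tensor N M)),
  [/\ (forall (M M' N N' : longDimodule H B) (f : longHom M M') (g : longHom N N')
         (m : M) (n : N),
         lh_fun (mtens S f g) (m ⊗ n) = f m ⊗ g n),
      (forall (U V W : longDimodule H B) (u : U) (v : V) (w : W),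
         lh_fun (massoc S U V W) ((u ⊗ v) ⊗ w) =
         auto_inv ld_map u ⊗ (v ⊗ ld_map w)),
      (forall (V : longDimodule H B) (a : k^o) (v : V),
         lh_fun (mlunit S V) (a ⊗ v) = a *: auto_inv ld_map v /\
         lh_fun (mrunit S V) (v ⊗ a) = a *: auto_inv ld_map v),
      is_braiding S C &
      (forall (M N : longDimodule H B) (m : M) (n : N),
         lh_fun (C M N) (m ⊗ n) =
         \sw_(b, m0 <- coact m) \sw_(c, n0 <- coact n) \sw_(R1, R2 <- R)
           ((form (b ⊗ c) : k) *:
             ((R2 ▹ auto_inv ld_map (auto_inv ld_map n0)) ⊗
              (R1 ▹ auto_inv ld_map (auto_inv ld_map m0)))))].
Proof.
exists (long_monoidal H B), (long_braid hR hform); split.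
- by move=> M M' N N' f g m n; exact: long_tmapE.
- by move=> U V W u v w; exact: long_assocE.
- by move=> V a v; split; [exact: long_lunitE|exact: long_runitE].
- exact: long_braid_is_braiding.
- by move=> M N m n; exact: long_braidE.
Qed.
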